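(* Let $0<p<\infty$, let $m$ be a positive integer, and let $r>0$. For any positive Borel measure $\mu$ on $\mathbb{C}$ the following two conditions are equivalent. (a) There exists a constant $C>0$ such that $$\int_{\mathbb{C}}\left|f(z)e^{-\frac12|z|^2}\right|^p\,d\mu(z)\le C\,\|f\|_{p,m}^p$$ for all $f\in F^{p,m}$. (b) There exists a constant $C>0$ such that $$\mu(B(z,r))\le C(1+|z|)^{mp}$$ for all $z\in\mathbb{C}$, where $B(z,r)=\{w\in\mathbb{C}:|w-z|<r\}$.
   Context: $dA$ is ordinary area (Lebesgue) measure on $\mathbb{C}$. For $0<p<\infty$, the Fock space $F^p$ is the space of entire functions $f$ such that $f(z)e^{-|z|^2/2}$ is in $L^p(\mathbb{C},dA)$, with $$\|f\|_p=\left[\frac p{2\pi}\int_{\mathbb{C}}\left|f(z)e^{-\frac12|z|^2}\right|^p dA(z)\right]^{1/p}.$$ For a positive integer $m$, the Fock-Sobolev space $F^{p,m}$ is the space of entire functions $f$ whose $m$-th derivative $f^{(m)}$ is in $F^p$; equivalently (a fact proved in the same work), the function $z^mf(z)$ is in $F^p$. For $f\in F^{p,m}$, $\|f\|_{p,m}$ denotes the $F^p$-norm $\|\cdot\|_p$ of the function $z\mapsto z^mf(z)$. *)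

(* Defs.v *)
From HB Require Import structures.
From mathcomp Require Import all_boot all_order all_algebra complex.
From mathcomp Require Import all_classical all_reals all_analysis.
From mathcomp Require Import measurable_realfun.

Set Implicit Arguments.
Unset Strict Implicit.
Unset Printing Implicit Defensive.

Import Order.TTheory GRing.Theory Num.Theory.
Import numFieldNormedType.Exports.
Import ComplexField.Normc.

Local Open Scope classical_set_scope.
Local Open Scope ring_scope.
Local Open Scope complex_scope.

(* R[i] as a normed space over itself, so that derivable and derive1n on
   functions R[i] -> R[i] are complex differentiability and derivatives. *)
HB.instance Definition _ (R : realType) :=
  PseudoPointedMetric.copy R[i] R[i]^o.
HB.instance Definition _ (R : realType) := NormedModule.copy R[i] R[i]^o.

HB.instance Definition _ (R : realType) :=
  Measurable.copy R[i] (g_sigma_algebraType (@open R[i])).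

Section fock.
Variable R : realType.

Definition complex_of_pair
  (xy : measurableTypeR R * measurableTypeR R) : R[i] := xy.1 +i* xy.2.

Lemma measurable_complex_of_pair : measurable_fun setT complex_of_pair.
Proof.
apply: (@measurability _ _ _ _ _ _ (@open R[i])) => // _ [U oU <-].
rewrite setTI.
pose box (k : rat * rat * nat) : set (measurableTypeR R * measurableTypeR R) :=
  ball (ratr k.1.1 : R) (k.2.+1%:R^-1) `*` ball (ratr k.1.2 : R) (k.2.+1%:R^-1).
have -> : complex_of_pair @^-1` U =
    \bigcup_(k in [set k | box k `<=` complex_of_pair @^-1` U]) box k.
  apply/seteqP; split=> [[x y] /= Uxy|xy [k /= kU] /kU //].
  have [e0 e00 eU] : exists2 e : R, 0 < e & ball (x +i* y) e%:C `<=` U.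
    have /nbhs_ballP[[e e'] /= e0 eU] : nbhs (x +i* y) U.
      by apply/open_nbhs_nbhs; split.
    move: e0; rewrite ltcE /= => /andP[/eqP e'0 e0].
    by exists e => //; rewrite e'0 in eU.
  have [n n4] : exists n, n.+1%:R^-1 < e0 / 4.
    have e4 : 0 < e0 / 4 by rewrite divr_gt0.
    have [n _ /(_ _ (leqnn n)) /= nE] := near_infty_natSinv_lt (PosNum e4).
    by exists n.
  have n0 : 0 < n.+1%:R^-1 :> R by rewrite invr_gt0.
  have [a xa] : exists a, ball x n.+1%:R^-1 (ratr a : R).
    suff : ball x n.+1%:R^-1 `&` range (@ratr R) !=set0.
      by move=> [/= _ []] /[swap] -[a _ <-]; exists a.
    by apply: dense_rat; [exists x; exact: ballxx|exact: ball_open].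
  have [b yb] : exists b, ball y n.+1%:R^-1 (ratr b : R).
    suff : ball y n.+1%:R^-1 `&` range (@ratr R) !=set0.
      by move=> [/= _ []] /[swap] -[b _ <-]; exists b.
    by apply: dense_rat; [exists y; exact: ballxx|exact: ball_open].
  exists (a, b, n) => /=; last by split=> /=; exact/ball_sym.
  move=> [x' y'] [/= xa' yb']; apply: eU; rewrite -ball_normE /=.
  have nx : `|x - x'| < 2 * n.+1%:R^-1.
    by rewrite mulr_natl mulr2n; exact: (ball_triangle xa xa').
  have ny : `|y - y'| < 2 * n.+1%:R^-1.
    by rewrite mulr_natl mulr2n; exact: (ball_triangle yb yb').
  have -> : x +i* y - complex_of_pair (x', y') =
      (x - x')%:C + 'i%C * (y - y')%:C.
    by rewrite /complex_of_pair /=; simpc.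
  rewrite (le_lt_trans (ler_normD _ _))// normrM.
  have -> : `|'i%C| = 1 :> R[i].
    by rewrite normc_def /= expr0n expr1n /= add0r sqrtr1.
  rewrite mul1r.
  have normR (u : R) : `|u%:C| = `|u|%:C.
    by rewrite normc_def /= expr0n /= addr0 sqrtr_sqr.
  rewrite !normR -rmorphD/= ltcR.
  apply: (lt_trans (ltrD nx ny)).
  by rewrite -mulrDl -natrD -ltr_pdivlMl// mulrC.
rewrite bigcup_mkcond; apply: countable_bigcupT_measurable => [|k].
  exact: countableP.
case: ifPn => // _; apply: measurableX; exact: measurable_ball.
Qed.

Local Open Scope ereal_scope.

Definition area : set R[i] -> \bar R :=
  pushforward (lebesgue_measure \x lebesgue_measure) complex_of_pair.

Let measurable_preimage (A : set R[i]) :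
  measurable A -> measurable (complex_of_pair @^-1` A).
Proof.
by move=> mA; rewrite -[X in measurable X]setTI; exact: measurable_complex_of_pair.
Qed.

Let area0 : area set0 = 0.
Proof. by rewrite /area /pushforward preimage_set0 measure0. Qed.

Let area_ge0 (A : set R[i]) : 0 <= area A.
Proof. by rewrite /area /pushforward; exact: measure_ge0. Qed.

Let area_sigma_additive : semi_sigma_additive area.
Proof.
move=> F mF tF mUF; rewrite /area /pushforward preimage_bigcup.
apply: measure_semi_sigma_additive.
- by move=> n; exact: measurable_preimage.
- apply/trivIsetP => /= i j _ _ ij; rewrite -preimage_setI.
  by move/trivIsetP : tF => /(_ _ _ _ _ ij) ->//; rewrite preimage_set0.
- by rewrite -preimage_bigcup; exact: measurable_preimage.
Qed.

HB.instance Definition _ := isMeasure.Build _ _ _ area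
  area0 area_ge0 area_sigma_additive.

Local Close Scope ereal_scope.

Definition disc (z : R[i]) (r : R) : set R[i] := [set w | normc (w - z) < r].

Definition entire (f : R[i] -> R[i]) : Prop := forall z, derivable f z 1.

Definition fock_weight (f : R[i] -> R[i]) (p : R) (z : R[i]) : R :=
  normc (f z * (expR (- (2^-1 * normc z ^+ 2)))%:C) `^ p.

Definition fock (p : R) : set (R[i] -> R[i]) :=
  [set f | entire f /\
           area.-integrable setT (fun z => (fock_weight f p z)%:E)].

Local Open Scope ereal_scope.

(* Takes values in \bar R: it is +oo when the integral diverges. *)
Definition fock_norm (p : R) (f : R[i] -> R[i]) : \bar R :=
  ((p / (2 * pi))%:E * \int[area]_z (fock_weight f p z)%:E) `^ p^-1.

Local Close Scope ereal_scope.

Definition fock_sobolev (p : R) (m : nat) : set (R[i] -> R[i]) :=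
  [set f | entire f /\ fock p (derive1n m f)].

Definition fock_sobolev_norm (p : R) (m : nat) (f : R[i] -> R[i]) : \bar R :=
  fock_norm p (fun z => z ^+ m * f z).

End fock.

(* Main.v *)
From HB Require Import structures.
Require Import Defs.
From mathcomp Require Import all_boot all_order all_algebra complex ring lra.
From mathcomp Require Import all_classical all_reals all_analysis.
From mathcomp Require Import measurable_realfun.
Import Order.TTheory GRing.Theory Num.Theory.
Import numFieldNormedType.Exports ComplexField.Normc.
Set Implicit Arguments.
Unset Strict Implicit.
Unset Printing Implicit Defensive.
Local Open Scope classical_set_scope.
Local Open Scope ring_scope.
Local Open Scope complex_scope.

(** Write phi(z) = |f(z) exp(- |z|^2 / 2)|^p.

The growth of mu is read off the functions f_a(z) = exp(conj(a) z). Completing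
the square, their weight is exp(p |a|^2 / 2) times the Gaussian
exp(- p |z - a|^2 / 2). On the disc of centre a and radius r it is at least
exp(p |a|^2 / 2 - p r^2 / 2), so the left-hand side of the embedding controls
the mass of that disc, while |z| <= (1 + |a|) (1 + |z - a|) bounds the
right-hand side by a multiple of exp(p |a|^2 / 2) (1 + |a|)^(m p)
([fock_kernel_norm_le]).

The embedding rests on the local estimate [fock_weight_disc_le]: phi(z) is at
most a constant times the area integral of phi over the disc of centre z and
radius r. Integrate this in mu and exchange the two integrals by Tonelli
([integral_disc_integral]): the integral of phi against mu is at most a
constant times the area integral of phi(w) mu(B(w, r)), hence, by the growth of
mu, of phi(w) (1 + |w|)^(m p). It remains to replace 1 + |w| by |w|
([fock_weight_growth_le]). Away from 0 the two are comparable; near 0, the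
local estimate shows that a small disc carries at most half of the mass that
phi gives to the unit disc, so that its mass can be absorbed.

For the local estimate, multiply f by w |-> exp(- conj(z) w): this recentres
the Gaussian weight at z, where it is bounded above and below on the disc.
What is left is that |g(z)|^p is at most a constant times the integral of
|g|^p over a disc around z, for g entire ([disc_submean_powR]). For p = 1 this
is the mean value property; a maximal function argument of Hardy and
Littlewood lowers the exponent to any p <= 1, and a power of g raises it again.

Functions are only assumed to be complex differentiable at each point, so the
mean value property is proved from Goursat's theorem on rectangles. It is
applied to w |-> f(zeta exp(w)), which has period 2 pi i: the horizontal
sides of a rectangle of height 2 pi cancel, the mean over a vertical segment
does not depend on its abscissa, and it tends to f(0) at -oo. This gives the
mean over all rotations of a point zeta; the mean over a disc follows by
integrating in zeta, since area is invariant under rotations. *)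

Section carleson.
Variable R : realType.

(** * The modulus, and derivatives measured with it *)

Lemma normE (z : R[i]) : `|z| = (normc z)%:C. Proof. by []. Qed.

(** The norm of R[i] takes its values in R[i]; this and the next lemmas trade it for
the real-valued modulus, with real epsilons. *)
Lemma nbhs_normcP (z : R[i]) (A : set R[i]) :
  nbhs z A <-> exists2 d : R, 0 < d & forall h, normc h < d -> A (z + h).
Proof.
split.
  move=> /nbhs_normP[[d d'] /= d0 dA].
  move: d0; rewrite ltcE /= => /andP[/eqP d'0 d0].
  exists d => // h hd; apply: dA => /=.
  by rewrite opprD addNKr normrN normE d'0 ltcR.
move=> [d d0 dA]; apply/nbhs_normP; exists d%:C; first by rewrite /= ltcR.
by move=> w /=; rewrite distrC normE ltcR => /dA; rewrite addrC subrK.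
Qed.

Lemma normc_ge0 (z : R[i]) : 0 <= normc z.
Proof. by case: z => a b; exact: sqrtr_ge0. Qed.

Lemma normc_gt0 (z : R[i]) : (0 < normc z) = (z != 0).
Proof.
rewrite lt_neqAle normc_ge0 andbT eq_sym; congr negb.
by apply/eqP/eqP => [/eq0_normc|->]; rewrite ?normc0.
Qed.

Lemma normcD (x y : R[i]) : normc (x + y) <= normc x + normc y.
Proof. exact: le_normcD. Qed.

Lemma normc_opp (x : R[i]) : normc (- x) = normc x.
Proof. exact: normcN. Qed.

Lemma normc_distC (x y : R[i]) : normc (x - y) = normc (y - x).
Proof. by rewrite -normc_opp opprB. Qed.

Lemma normc_sqr (a b : R) : normc (a +i* b) ^+ 2 = a ^+ 2 + b ^+ 2.
Proof. by rewrite /= sqr_sqrtr// addr_ge0// sqr_ge0. Qed.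

Lemma normc_real (x : R) : normc x%:C = `|x|.
Proof. by rewrite /= expr0n addr0 sqrtr_sqr. Qed.

Lemma ler_Re_normc (z : R[i]) : `|complex.Re z| <= normc z.
Proof. by case: z => a b /=; rewrite -sqrtr_sqr ler_wsqrtr// lerDl sqr_ge0. Qed.

Lemma ler_Im_normc (z : R[i]) : `|complex.Im z| <= normc z.
Proof. by case: z => a b /=; rewrite -sqrtr_sqr ler_wsqrtr// lerDr sqr_ge0. Qed.

Lemma normc_le_ReIm (a b : R) : normc (a +i* b) <= `|a| + `|b|.
Proof.
rewrite -[_ +i* _]/(a +i* b) -(ler_pXn2r (n:=2)) ?nnegrE ?normc_ge0 ?addr_ge0//.
rewrite normc_sqr sqrrD !real_normK ?num_real// -addrA lerD2l lerDr.
by rewrite mulrn_wge0// mulr_ge0.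
Qed.

Lemma normcX (z : R[i]) n : normc (z ^+ n) = normc z ^+ n.
Proof. by elim: n => [|n IH]; rewrite ?expr0 ?normc1// !exprS normcM IH. Qed.

Lemma derivable_normc (f : R[i] -> R[i]) z : derivable f z 1 ->
  exists l, forall e : R, 0 < e -> exists2 d : R, 0 < d &
    forall h, normc h < d ->
      normc (f (z + h) - f z - l * h) <= e * normc h.
Proof.
move=> /derivable_nbhs /eqaddoP df; exists ('D_1 f z) => e e0.
have /df/nbhs_normcP[d d0 H] : (0 : R[i]) < e%:C by rewrite ltcR.
exists d => // h hd; move: (H h hd).
rewrite add0r /= !fctE /= !normE -rmorphM /= lecR [_ *: 1]mulr1.
by rewrite opprD addrA (addrC h) [h *: _]mulrC.
Qed.

Lemma is_derive_normc (f : R[i] -> R[i]) (z l : R[i]) :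
  (forall e : R, 0 < e -> exists2 d : R, 0 < d &
    forall h, normc h < d ->
      normc (f (z + h) - f z - l * h) <= e * normc h) -> is_derive z 1 f l.
Proof.
move=> H.
have c : h^-1 *: ((f \o shift z) (h *: 1) - f z) @[h --> (0:R[i])^'] --> l.
  apply/cvgrPdist_le => -[e e'] /=.
  rewrite ltcE /= => /andP[/eqP -> e0].
  have [d d0 Hd] := H _ e0.
  rewrite near_withinE; apply/nbhs_normcP; exists d => // h hd; rewrite add0r => h0.
  have nh0 : 0 < normc h by rewrite normc_gt0.
  rewrite normE lecR -(ler_pM2r nh0) -normcM; apply: le_trans (Hd h hd).
  rewrite [h%:A]mulr1 -[_ *: _]/(h^-1 * _) (mulrC h^-1) mulrBl mulfVK// normc_distC.
  by rewrite (addrC h).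
by apply: DeriveDef; [apply/cvg_ex; exists l|exact: cvg_lim].
Qed.

(** * The complex exponential *)

Definition cexp (z : R[i]) : R[i] :=
  (expR (complex.Re z) * cos (complex.Im z)) +i*
  (expR (complex.Re z) * sin (complex.Im z)).

Lemma cexpD (z w : R[i]) : cexp (z + w) = cexp z * cexp w.
Proof.
case: z w => a b [c d]; rewrite /cexp /= expRD cosD sinD; simpc.
by congr (_ +i* _); ring.
Qed.

Lemma normc_cexp (z : R[i]) : normc (cexp z) = expR (complex.Re z).
Proof.
apply/eqP; rewrite -(eqrXn2 (n:=2)) ?normc_ge0 ?expR_ge0//.
by rewrite normc_sqr !exprMn -mulrDr cos2Dsin2 mulr1.
Qed.

Lemma is_derive_normr (f : R -> R) (l x : R) : is_derive x 1 f l ->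
  forall e : R, 0 < e -> exists2 d : R, 0 < d &
    forall h, `|h| < d -> `|f (x + h) - f x - l * h| <= e * `|h|.
Proof.
move=> [/derivable_nbhs/eqaddoP df dl] e e0.
have /nbhs_normP[d d0 H] := df _ e0.
exists d => // h hd; have := H h; rewrite /= sub0r normrN => /(_ hd).
rewrite !fctE /= [_ *: 1]mulr1 opprD addrA (addrC h).
by rewrite [h *: _]mulrC -[l]dl.
Qed.

Lemma cexp_near0 (e : R) : 0 < e -> exists2 d : R, 0 < d &
  forall h, normc h < d -> normc (cexp h - 1 - h) <= e * normc h.
Proof.
move=> e0.
(* cexp h - 1 - h has real part (exp x - 1 - x) + exp x (cos y - 1) and
   imaginary part exp x (sin y - y) + (exp x - 1) y; with exp x <= 3 the four
   terms are at most 1/16, 3/16, 3/16 and 1/2 of e |h|. *)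
have e16 : 0 < e / 16 by rewrite divr_gt0.
have [d1 d10 Hexp] := is_derive_normr (is_derive_expR 0) e16.
have [d2 d20 Hcos] := is_derive_normr (is_derive_cos 0) e16.
have [d3 d30 Hsin] := is_derive_normr (is_derive_sin 0) e16.
have [d4 d40 Hexp1] := is_derive_normr (is_derive_expR 0) (ltr01 : 0 < 1 :> R).
have m0 : 0 < e / 4 by rewrite divr_gt0.
exists (Num.min (Num.min d1 d2) (Num.min (Num.min d3 d4) (Num.min (e / 4) 1))).
  by rewrite !lt_min d10 d20 d30 d40 m0 ltr01.
move=> [x y]; rewrite !lt_min.
move=> /andP[/andP[h1 h2] /andP[/andP[h3 h4] /andP[h5 h6]]].
have xh := ler_Re_normc (x +i* y); have yh := ler_Im_normc (x +i* y).
rewrite /= -/(normc (x +i* y)) in xh yh.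
move: (Hexp x) (Hcos y) (Hsin y) (Hexp1 x).
rewrite !add0r expR0 cos0 sin0 oppr0 mul0r !mul1r !subr0.
move=> /(_ (le_lt_trans xh h1)) E1 /(_ (le_lt_trans yh h2)) E2.
move=> /(_ (le_lt_trans yh h3)) E3 /(_ (le_lt_trans xh h4)) E4.
set N := normc (x +i* y) in xh yh h1 h2 h3 h4 h5 h6 *.
have N0 : 0 <= N := normc_ge0 _.
have ex1 : `|expR x - 1| <= 2 * N.
  by rewrite -[expR x - 1](subrK x) (le_trans (ler_normD _ _))//; lra.
have ex3 : expR x <= 3 by move: ex1; rewrite ler_norml => /andP[_]; lra.
have -> : cexp (x +i* y) - 1 - (x +i* y) =
    (expR x - 1 - x + expR x * (cos y - 1)) +i*
    (expR x * (sin y - y) + (expR x - 1) * y).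
  by rewrite /cexp /=; simpc; congr (_ +i* _); ring.
rewrite addr0 in E3.
have eN (x' : R) : `|x'| <= N -> e / 16 * `|x'| <= e / 16 * N.
  by move=> ?; rewrite ler_wpM2l// ltW.
have exM (t : R) : `|t| <= e / 16 * N -> `|expR x * t| <= 3 * (e / 16 * N).
  by move=> ?; rewrite normrM ler_pM// ger0_norm// expR_ge0.
have B1 := exM _ (le_trans E2 (eN _ yh)).
have B2 := exM _ (le_trans E3 (eN _ yh)).
have B3 : `|(expR x - 1) * y| <= e / 2 * N.
  by rewrite normrM ler_pM//; lra.
have B4 := le_trans E1 (eN _ xh).
apply: (le_trans (normc_le_ReIm _ _)).
have := ler_normD (expR x - 1 - x) (expR x * (cos y - 1)).
have := ler_normD (expR x * (sin y - y)) ((expR x - 1) * y).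
have := mulr_ge0 (ltW e0) N0.
lra.
Qed.

Lemma is_derive_cexpZ (c z : R[i]) :
  is_derive z 1 (fun w => cexp (c * w)) (c * cexp (c * z)).
Proof.
apply: is_derive_normc => e e0.
set k := expR (complex.Re (c * z)); have k0 : 0 < k by exact: expR_gt0.
have c0 : 0 < normc c + 1 by rewrite ltr_wpDl// normc_ge0.
have [d d0 H] := cexp_near0 (divr_gt0 e0 (mulr_gt0 k0 c0)).
exists (d / (normc c + 1)); first by rewrite divr_gt0.
move=> h hd; have ch : normc (c * h) <= (normc c + 1) * normc h.
  by rewrite normcM ler_wpM2r ?normc_ge0// lerDl.
have /H {}H : normc (c * h) < d by rewrite (le_lt_trans ch)// mulrC -ltr_pdivlMr.
have -> : cexp (c * (z + h)) - cexp (c * z) - c * cexp (c * z) * h =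
    cexp (c * z) * (cexp (c * h) - 1 - c * h) by rewrite mulrDr cexpD; ring.
rewrite normcM normc_cexp -/k -ler_pdivlMl//; apply: (le_trans H).
rewrite [leRHS](_ : _ = e / (k * (normc c + 1)) * ((normc c + 1) * normc h)).
  by rewrite ler_wpM2l// ltW// divr_gt0// mulr_gt0.
by field; rewrite !gt_eqF.
Qed.

Lemma entire_cexp : entire cexp.
Proof.
move=> z; have [] := is_derive_cexpZ 1 z.
by rewrite (_ : (fun w => cexp (1 * w)) = cexp)//; apply/funext => w; rewrite mul1r.
Qed.

(** * Integrals of continuous functions over a segment *)

Definition itvint (a b : R) (f : R -> R) : R :=
  \int[@lebesgue_measure R]_(x in `[a, b]) f x.

Lemma itvint_integrable (f : R -> R) (a b : R) : continuous f ->
  (@lebesgue_measure R).-integrable `[a, b] (EFin \o f).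
Proof.
move=> cf; apply: continuous_compact_integrable; first exact: segment_compact.
exact: continuous_subspaceT.
Qed.

Lemma itvint_split (f : R -> R) (a b c : R) : continuous f -> a <= c -> c <= b ->
  itvint a b f = itvint a c f + itvint c b f.
Proof.
move=> cf ac cb.
have /(_ c) := @Rintegral_itvB R f (BLeft a) (BRight b) _ (itvint_integrable a b cf).
rewrite !bnd_simp => /(_ ac cb).
rewrite Rintegral_itv_obnd_cbnd; last first.
  apply: integrableS (itvint_integrable c b cf) => //.
  exact: subset_itv_oc_cc.
by rewrite /itvint => <-; rewrite addrC subrK.
Qed.

Lemma itvintB (f g : R -> R) (a b : R) : continuous f -> continuous g ->
  itvint a b (fun x => f x - g x) = itvint a b f - itvint a b g.
Proof. by move=> cf cg; apply: RintegralB => //; exact: itvint_integrable. Qed.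

Lemma itvint_near_cst (f : R -> R) (a b c e : R) : continuous f -> a <= b ->
  (forall x, a <= x <= b -> `|f x - c| <= e) ->
  `|itvint a b f - c * (b - a)| <= e * (b - a).
Proof.
move=> cf ab H.
have ccst (k : R) : itvint a b (fun=> k) = k * (b - a).
  rewrite /itvint Rintegral_cst//.
  congr (k * _); rewrite (congr1 fine (lebesgue_measure_itv `[a, b]))/= lte_fin.
  by case: ltgtP ab => //= ->; rewrite subrr.
rewrite -ccst -itvintB//; last exact: cst_continuous.
have ci : continuous (fun x => f x - c).
  by move=> x; apply: cvgB; [exact: cf|exact: cvg_cst].
have cn : continuous (fun x : R => `|f x - c|).
  by move=> x; apply: cvg_norm; exact: ci.
have ce : continuous (fun _ : R => e) by exact: cst_continuous.
rewrite (le_trans (le_normr_Rintegral _ (itvint_integrable a b ci)))//.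
rewrite -ccst /itvint; apply: le_Rintegral => //.
- exact: itvint_integrable cn.
- exact: itvint_integrable ce.
Qed.

(** * Goursat's theorem for rectangles *)

Lemma nested_limit (a : nat -> R) (w : R) : 0 <= w ->
  (forall n, a n <= a n.+1 <= a n + w / 2 ^+ n.+1) ->
  exists x, forall n, a n <= x <= a n + w / 2 ^+ n.
Proof.
move=> w0 H.
have halfE n : w / 2 ^+ n.+1 = w / 2 ^+ n / 2 by rewrite exprSr invfM mulrA.
have inc n k : a n <= a (n + k)%N.
  elim: k => [|k IH]; first by rewrite addn0.
  by rewrite addnS (le_trans IH)//; case/andP: (H (n + k)%N).
have dec n k : a (n + k)%N + w / 2 ^+ (n + k) <= a n + w / 2 ^+ n.
  elim: k => [|k]; first by rewrite addn0.
  apply: le_trans; rewrite addnS; case/andP: (H (n + k)%N) => _ Hk.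
  by move: Hk; rewrite halfE; lra.
have wn n : 0 <= w / 2 ^+ n by rewrite divr_ge0// exprn_ge0.
have ub n k : a k <= a n + w / 2 ^+ n.
  have [/subnKC <-|/ltnW/subnKC <-] := leqP n k.
    by rewrite (le_trans _ (dec n (k - n)%N))// lerDl.
  by rewrite (le_trans (inc k (n - k)%N))// lerDl.
exists (sup (range a)) => n; apply/andP; split.
  apply: ub_le_sup; last by exists n.
  by exists (a 0%N + w / 2 ^+ 0) => _ [k _ <-]; exact: ub.
apply: ge_sup; first by exists (a 0%N), 0%N.
by move=> _ [k _ <-]; exact: ub.
Qed.

(** Goursat's subdivision argument, for any additive function of a rectangle that is
infinitesimal with respect to the square of the size at each point. If J is not
zero on a rectangle, some quarter of it keeps a quarter of |J|; iterating, the
nested rectangles shrink to a point where the local estimate is violated. *)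
Lemma additive_rectangle_function_eq0 (J : R -> R -> R -> R -> R) :
  (forall a m b c d, a <= m -> m <= b -> c <= d ->
     J a b c d = J a m c d + J m b c d) ->
  (forall a b c m d, a <= b -> c <= m -> m <= d ->
     J a b c d = J a b c m + J a b m d) ->
  (forall x y e, 0 < e -> exists2 r, 0 < r & forall a b c d,
     a <= x <= b -> c <= y <= d -> b - a < r -> d - c < r ->
     `|J a b c d| <= e * (b - a + (d - c)) ^+ 2) ->
  forall a b c d, a <= b -> c <= d -> J a b c d = 0.
Proof.
move=> Jh Jv Jloc a b c d ab cd; apply: contrapT => /eqP J0.
pose k : R := `|J a b c d|; have k0 : 0 < k by rewrite normr_gt0.
set w := b - a; set h := d - c.
have w0 : 0 <= w by rewrite subr_ge0.
have h0 : 0 <= h by rewrite subr_ge0.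
have halfE (t : R) n : t / 2 ^+ n.+1 = t / 2 ^+ n / 2.
  by rewrite exprSr invfM mulrA.
have tn (t : R) n : 0 <= t -> 0 <= t / 2 ^+ n.
  by move=> ?; rewrite divr_ge0// exprn_ge0.
(* q is the lower left corner of a rectangle of the n-th generation. *)
pose P n (q : R * R) := k / 4 ^+ n <=
  `|J q.1 (q.1 + w / 2 ^+ n) q.2 (q.2 + h / 2 ^+ n)|.
have step (z : nat * (R * R)) : exists q' : R * R, P z.1 z.2 ->
    [/\ P z.1.+1 q', z.2.1 <= q'.1 <= z.2.1 + w / 2 ^+ z.1.+1 &
      z.2.2 <= q'.2 <= z.2.2 + h / 2 ^+ z.1.+1].
  case: z => n [x y]; rewrite /P /= !halfE.
  set s := w / 2 ^+ n / 2; set t := h / 2 ^+ n / 2.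
  have s0 : 0 <= s by rewrite divr_ge0// tn.
  have t0 : 0 <= t by rewrite divr_ge0// tn.
  have -> : w / 2 ^+ n = s + s by rewrite /s; lra.
  have -> : h / 2 ^+ n = t + t by rewrite /t; lra.
  have -> : k / 4 ^+ n.+1 = k / 4 ^+ n / 4 by rewrite exprSr invfM mulrA.
  set K : R := k / 4 ^+ n.
  have xs : x <= x + s by rewrite lerDl.
  have ys : y <= y + t by rewrite lerDl.
  have xss : x + s <= x + (s + s) by rewrite addrA lerDl.
  have yss : y + t <= y + (t + t) by rewrite addrA lerDl.
  rewrite (Jh _ _ _ _ _ xs xss (le_trans ys yss)).
  rewrite (Jv _ _ _ _ _ xs ys yss) (Jv _ _ _ _ _ xss ys yss).
  rewrite !(addrA x) !(addrA y).
  set A := J x _ y _; set B := J x _ (y + t) _.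
  set C := J (x + s) _ y _; rewrite addrA; set D := J (x + s) _ (y + t) _.
  have [?|HA] := leP (K / 4) `|A|.
    by exists (x, y) => _; split; rewrite //= ?lexx ?lerDl ?s0 ?t0.
  have [?|HB] := leP (K / 4) `|B|.
    by exists (x, y + t) => _; split; rewrite //= ?lexx ?lerDl ?s0 ?t0.
  have [?|HC] := leP (K / 4) `|C|.
    by exists (x + s, y) => _; split; rewrite //= ?lexx ?lerDl ?s0 ?t0.
  have [?|HD] := leP (K / 4) `|D|.
    by exists (x + s, y + t) => _; split; rewrite //= ?lexx ?lerDl ?s0 ?t0.
  exists (x, y) => HK; exfalso.
  have := le_trans HK (ler_normD _ _).
  have := ler_normD (A + B) C; have := ler_normD A B; lra.
have [f Hf] := choice step.
pose q := fix q n := if n is n'.+1 then f (n', q n') else (a, c).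
have Pq n : P n (q n).
  elim: n => [|n IH]; last by have [] := Hf (n, q n) IH.
  by rewrite /P /= !expr0 !divr1 /w /h !(addrC _ (_ - _)) !subrK.
have [x xP] : exists x, forall n, (q n).1 <= x <= (q n).1 + w / 2 ^+ n.
  by apply: nested_limit => // n; have [] := Hf (n, q n) (Pq n).
have [y yP] : exists x, forall n, (q n).2 <= x <= (q n).2 + h / 2 ^+ n.
  by apply: nested_limit => // n; have [] := Hf (n, q n) (Pq n).
have S0 : 0 < (w + h) ^+ 2 + 1 by rewrite ltr_wpDl// sqr_ge0.
have [r r0 Hr] := Jloc x y _ (divr_gt0 k0 S0).
have [n nr] : exists n, (w + h) / 2 ^+ n < r.
  exists (Num.bound ((w + h) / r)).
  rewrite ltr_pdivrMr ?exprn_gt0// mulrC -ltr_pdivrMr//.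
  exact: upper_nthrootP.
have wn := tn _ n w0; have hn := tn _ n h0.
have wh : w / 2 ^+ n + h / 2 ^+ n = (w + h) / 2 ^+ n by rewrite [RHS]mulrDl.
have sub1 (u v : R) : u + v - u = v by rewrite addrC addKr.
have := Hr _ _ _ _ (xP n) (yP n); rewrite !sub1 wh.
have wr : w / 2 ^+ n < r by rewrite (le_lt_trans _ nr)// -wh lerDl.
have hr : h / 2 ^+ n < r by rewrite (le_lt_trans _ nr)// -wh lerDr.
move=> /(_ wr hr)/(le_trans (Pq n)).
have -> : ((w + h) / 2 ^+ n) ^+ 2 = (w + h) ^+ 2 / 4 ^+ n.
  rewrite expr_div_n -exprM muln2 -addnn exprD -exprMn.
  by congr (_ / _ ^+ _); lra.
rewrite mulrA ler_pM2r ?invr_gt0 ?exprn_gt0//.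
by rewrite mulrAC ler_pdivlMr// ler_pM2l//; lra.
Qed.

Lemma continuous_Re : continuous (@complex.Re R).
Proof.
move=> z A /nbhs_normP[e e0 eA]; apply/nbhs_normcP; exists e => // h he.
apply: eA => /=; apply: le_lt_trans he; case: z h => a b [c d].
by rewrite distrC /= addrC addKr (ler_Re_normc (c +i* d)).
Qed.

Lemma continuous_Im : continuous (@complex.Im R).
Proof.
move=> z A /nbhs_normP[e e0 eA]; apply/nbhs_normcP; exists e => // h he.
apply: eA => /=; apply: le_lt_trans he; case: z h => a b [c d].
by rewrite distrC /= addrC addKr (ler_Im_normc (c +i* d)).
Qed.

Lemma continuous_normc : continuous (@normc R : R[i] -> R).
Proof.
move=> z A /nbhs_normP[e e0 eA]; apply/nbhs_normcP; exists e => // h he.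
apply: eA => /=; apply: le_lt_trans he; rewrite ler_norml.
have := normcD z h; have := normcD (z + h) (- h); rewrite addrK normc_opp => *.
apply/andP; split; lra.
Qed.

Lemma continuous_hline (c : R) : continuous (fun x : R => x +i* c).
Proof.
move=> x A /nbhs_normcP[d d0 dA]; apply/nbhs_normP; exists d => // y /= xy.
have -> : y +i* c = x +i* c + (y - x)%:C by simpc; rewrite addrC subrK.
by apply: dA; rewrite normc_real distrC.
Qed.

Lemma continuous_vline (c : R) : continuous (fun x : R => c +i* x).
Proof.
move=> x A /nbhs_normcP[d d0 dA]; apply/nbhs_normP; exists d => // y /= xy.
have -> : c +i* y = c +i* x + (0 +i* (y - x)) by simpc; rewrite [x + _]addrC subrK.
by apply: dA; rewrite /= expr0n add0r sqrtr_sqr distrC.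
Qed.

Lemma entire_continuous (f : R[i] -> R[i]) : entire f -> continuous f.
Proof. by move=> ef z; apply/differentiable_continuous/derivable1_diffP/ef. Qed.

Lemma continuous_Re_hline (G : R[i] -> R[i]) (c : R) : entire G ->
  continuous (fun x : R => complex.Re (G (x +i* c))).
Proof.
move=> eG x.
apply: (continuous_comp (f := fun x => G (x +i* c))); last exact: continuous_Re.
by apply: continuous_comp; [exact: continuous_hline|exact: entire_continuous].
Qed.

Lemma continuous_vline_comp (G : R[i] -> R[i]) (g : R[i] -> R) (c : R) :
  entire G -> continuous g -> continuous (fun y : R => g (G (c +i* y))).
Proof.
move=> eG cg x; apply: (continuous_comp (f := fun x => G (c +i* x))); last exact: cg.
by apply: continuous_comp; [exact: continuous_vline|exact: entire_continuous].
Qed.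

Lemma continuous_Im_vline (G : R[i] -> R[i]) (c : R) : entire G ->
  continuous (fun y : R => complex.Im (G (c +i* y))).
Proof. by move=> eG; apply: continuous_vline_comp => //; exact: continuous_Im. Qed.

(** The real part of the contour integral of G along the boundary of the rectangle
with sides [a, b] and [c, d], horizontal sides first. Applied to multiples of
G, the real part is enough to recover the whole integral, and it only involves
integrals of real functions. *)
Definition Re_contour (G : R[i] -> R[i]) (a b c d : R) : R :=
  itvint a b (fun x => complex.Re (G (x +i* c))) -
  itvint a b (fun x => complex.Re (G (x +i* d))) -
  (itvint c d (fun y => complex.Im (G (b +i* y))) -
   itvint c d (fun y => complex.Im (G (a +i* y)))).

(** The contour integral of the affine part of G at (x, y) vanishes: its two pairs
of sides contribute the same number Im(G') (b - a) (d - c). The error term is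
at most e times the diameter on a contour of comparable length. *)
Lemma Re_contour_local (G : R[i] -> R[i]) (x y e : R) :
  entire G -> 0 < e -> exists2 r : R, 0 < r &
  forall a b c d, a <= x <= b -> c <= y <= d -> b - a < r -> d - c < r ->
  `|Re_contour G a b c d| <= e * (b - a + (d - c)) ^+ 2.
Proof.
move=> entG e0; have dG : derivable G (x +i* y) 1 by exact: entG.
have [l Hl] := derivable_normc dG.
have [r r0 Hr] := Hl _ (divr_gt0 e0 (ltr0n R 2)).
exists (r / 2); first by rewrite divr_gt0.
move=> a b c d /andP[ax xb] /andP[cy yd] abr cdr.
have ab := le_trans ax xb; have cd := le_trans cy yd.
set S := b - a + (d - c).
pose E w := G w - G (x +i* y) - l * (w - (x +i* y)).
have HE u v : a <= u <= b -> c <= v <= d -> normc (E (u +i* v)) <= e / 2 * S.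
  move=> /andP[au ub] /andP[cv vd].
  have hS : normc ((u +i* v) - (x +i* y)) <= S.
    have -> : (u +i* v) - (x +i* y) = (u - x) +i* (v - y) by simpc.
    apply: (le_trans (normc_le_ReIm _ _)); rewrite /S lerD// ler_norml; lra.
  have /Hr : normc ((u +i* v) - (x +i* y)) < r.
    by apply: (le_lt_trans hS); rewrite /S; lra.
  rewrite [x +i* y + _]addrC subrK => /le_trans; apply.
  by rewrite ler_wpM2l// ltW// divr_gt0.
rewrite /Re_contour -!itvintB;
  try exact: continuous_Re_hline; try exact: continuous_Im_vline.
have Hh : `|itvint a b
      (fun t => complex.Re (G (t +i* c)) - complex.Re (G (t +i* d))) -
    complex.Im l * (d - c) * (b - a)| <= e * S * (b - a).
  apply: itvint_near_cst => //.
    by move=> t; apply: cvgB; exact: continuous_Re_hline.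
  move=> t tab.
  have H1 := HE t c tab; have H2 := HE t d tab.
  move: H1 H2; rewrite !lexx cd => /(_ isT) H1 /(_ isT) H2.
  have -> : complex.Re (G (t +i* c)) - complex.Re (G (t +i* d)) -
      complex.Im l * (d - c) = complex.Re (E (t +i* c)) - complex.Re (E (t +i* d)).
    rewrite /E; case: (G _) => ? ?; case: (G _) => ? ?; case: (G _) => ? ?.
    by case: (l) => ? ?; rewrite /=; ring.
  apply: (le_trans (ler_normB _ _)).
  have := le_trans (ler_Re_normc _) H1; have := le_trans (ler_Re_normc _) H2; lra.
have Hv : `|itvint c d
      (fun t => complex.Im (G (b +i* t)) - complex.Im (G (a +i* t))) -
    complex.Im l * (b - a) * (d - c)| <= e * S * (d - c).
  apply: itvint_near_cst => //.
    by move=> t; apply: cvgB; exact: continuous_Im_vline.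
  move=> t tab.
  have H1 := HE a t; have H2 := HE b t.
  move: H1 H2; rewrite !lexx ab => /(_ isT tab) H1 /(_ isT tab) H2.
  have -> : complex.Im (G (b +i* t)) - complex.Im (G (a +i* t)) -
      complex.Im l * (b - a) = complex.Im (E (b +i* t)) - complex.Im (E (a +i* t)).
    rewrite /E; case: (G _) => ? ?; case: (G _) => ? ?; case: (G _) => ? ?.
    by case: (l) => ? ?; rewrite /=; ring.
  apply: (le_trans (ler_normB _ _)).
  have := le_trans (ler_Im_normc _) H1; have := le_trans (ler_Im_normc _) H2; lra.
set I1 := itvint a b _ in Hh *; set I2 := itvint c d _ in Hv *.
have -> : I1 - I2 = (I1 - complex.Im l * (d - c) * (b - a)) -
                    (I2 - complex.Im l * (b - a) * (d - c)) by ring.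
apply: (le_trans (ler_normB _ _)); apply: (le_trans (lerD Hh Hv)).
by rewrite -mulrDr -/S expr2 mulrA.
Qed.

Lemma goursat (G : R[i] -> R[i]) (a b c d : R) : entire G ->
  a <= b -> c <= d -> Re_contour G a b c d = 0.
Proof.
move=> eG; move: a b c d.
apply: additive_rectangle_function_eq0.
- move=> a m b c d am mb cd; rewrite /Re_contour.
  rewrite !(itvint_split _ am mb)//; try exact: continuous_Re_hline.
  ring.
- move=> a b c m d ab cm md; rewrite /Re_contour.
  rewrite !(itvint_split _ cm md)//; try exact: continuous_Im_vline.
  ring.
- by move=> x y e; exact: Re_contour_local.
Qed.

(** * Entire functions *)

Lemma entireM (f g : R[i] -> R[i]) : entire f -> entire g ->
  entire (fun z => f z * g z).
Proof. by move=> ef eg z; apply: derivableM; [exact: ef|exact: eg]. Qed.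

Lemma entire_comp (f g : R[i] -> R[i]) : entire f -> entire g ->
  entire (fun z => f (g z)).
Proof.
move=> ef eg z; apply/derivable1_diffP.
by apply: differentiable_comp; apply/derivable1_diffP; [exact: eg|exact: ef].
Qed.

Lemma entire_cst (c : R[i]) : entire (fun=> c).
Proof. by move=> z; exact: derivable_cst. Qed.

Lemma entire_id : entire (fun z : R[i] => z).
Proof. by move=> z; exact: derivable_id. Qed.

Lemma entireX (f : R[i] -> R[i]) (n : nat) : entire f -> entire (fun z => f z ^+ n).
Proof.
move=> ef; elim: n => [|n IH].
  by under eq_fun do rewrite expr0; exact: entire_cst.
by under eq_fun do rewrite exprS; exact: entireM.
Qed.

Lemma entireD (f g : R[i] -> R[i]) : entire f -> entire g ->
  entire (fun z => f z + g z).
Proof. by move=> ef eg z; apply: derivableD; [exact: ef|exact: eg]. Qed.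

Lemma entireZ (c : R[i]) (f : R[i] -> R[i]) : entire f ->
  entire (fun z => c * f z).
Proof. by move=> ef; apply: entireM; [exact: entire_cst|exact: ef]. Qed.

(** * The mean value property on circles *)

Lemma cexp_period (x : R) : cexp (x +i* (2 * pi)) = cexp (x +i* 0).
Proof. by rewrite /cexp /= mulr_natl cos2pi sin2pi cos0 sin0. Qed.

(** The contour integral of G(w) = i f(zeta exp(w)) over the rectangle with sides
[s, 0] and [0, 2 pi] compares the means of Re f over two circles of radii
|zeta| exp(s) and |zeta|. The horizontal sides cancel by periodicity, and the
smaller circle shrinks to 0 as s tends to -oo. Writing the circle as the set of
rotations of zeta avoids a case distinction on zeta = 0 and polar
coordinates. *)
Lemma circle_mean_Re (f : R[i] -> R[i]) (zeta : R[i]) : entire f ->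
  itvint 0 (2 * pi) (fun t => complex.Re (f (zeta * cexp (0 +i* t)))) =
  complex.Re (f 0) * (2 * pi).
Proof.
move=> ef.
pose G w := 'i%C * f (zeta * cexp w).
have eG : entire G.
  apply: entireZ; apply: (entire_comp ef); apply: entireZ; exact: entire_cexp.
have ImG s : (fun t => complex.Im (G (s +i* t))) =
    (fun t => complex.Re (f (zeta * cexp (s +i* t)))).
  by apply/funext => t; rewrite /G; case: (f _) => a b /=; ring.
have pi2 : 0 <= 2 * pi :> R by rewrite mulr_ge0// pi_ge0.
have shift s : s <= 0 ->
    itvint 0 (2 * pi) (fun t => complex.Re (f (zeta * cexp (0 +i* t)))) =
    itvint 0 (2 * pi) (fun t => complex.Re (f (zeta * cexp (s +i* t)))).
  move=> s0; have := goursat eG s0 pi2; rewrite /Re_contour.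
  have -> : (fun x => complex.Re (G (x +i* (2 * pi)))) =
            (fun x => complex.Re (G (x +i* 0))).
    by apply/funext => x; rewrite /G cexp_period.
  rewrite subrr sub0r => /eqP; rewrite oppr_eq0 subr_eq0 => /eqP.
  by rewrite !ImG.
apply/eqP; rewrite -subr_eq0 -normr_le0; apply/ler_addgt0Pl => e e0.
rewrite addr0.
have e1 : 0 < e / (2 * pi) by rewrite divr_gt0// mulr_gt0// pi_gt0.
have cf := entire_continuous ef.
have /(_ _)/nbhs_normcP[|d d0 Hd] := cf 0 (fun w => normc (w - f 0) < e / (2 * pi)).
  by apply/nbhs_normcP; exists (e / (2 * pi)) => // h; rewrite addrC addKr.
(* |zeta| exp(s) < d, even when zeta = 0. *)
pose s := Num.min 0 (ln (d / (normc zeta + 1))).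
have s0 : s <= 0 by rewrite /s ge_min lexx.
rewrite (shift _ s0).
have -> : e = e / (2 * pi) * (2 * pi - 0).
  by rewrite subr0 divfK// gt_eqF// mulr_gt0// pi_gt0.
rewrite -[X in _ - _ * X]subr0; apply: itvint_near_cst => //.
  by rewrite -ImG; exact: continuous_Im_vline.
move=> t _.
have := Hd (zeta * cexp (s +i* t)); rewrite /= add0r => H.
have -> : complex.Re (f (zeta * cexp (s +i* t))) - complex.Re (f 0) =
  complex.Re (f (zeta * cexp (s +i* t)) - f 0) by case: (f _) => ? ?; case: (f 0).
rewrite (le_trans (ler_Re_normc _))// ltW// H//.
rewrite normcM normc_cexp /=.
have z1 : 0 < normc zeta + 1 by rewrite ltr_wpDl// normc_ge0.
have : expR s <= d / (normc zeta + 1).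
  by rewrite -[leRHS]lnK ?posrE ?divr_gt0// ler_expR /s ge_min lexx orbT.
rewrite ler_pdivlMr// mulrDr mulr1 mulrC.
by have := expR_gt0 s; lra.
Qed.

(** Rotate f so that f(0) is a nonnegative real number. *)
Lemma circle_mean_normc (f : R[i] -> R[i]) (zeta : R[i]) : entire f ->
  normc (f 0) * (2 * pi) <=
  itvint 0 (2 * pi) (fun t => normc (f (zeta * cexp (0 +i* t)))).
Proof.
move=> ef; have [f0|f0] := eqVneq (f 0) 0.
  by rewrite f0 normc0 mul0r /itvint; apply: Rintegral_ge0 => t _; exact: normc_ge0.
pose u : R[i] := (f 0)^*%C / (normc (f 0))%:C.
have eu : entire (fun z => u * f z) by exact: entireZ.
have nu : normc u = 1.
  rewrite /u normcM normcV normc_real ger0_norm ?normc_ge0//.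
  suff -> : normc (f 0)^*%C = normc (f 0) by rewrite divff// gt_eqF// normc_gt0.
  by case: (f 0) => a b /=; rewrite sqrrN.
have uf : u * f 0 = (normc (f 0))%:C.
  rewrite /u mulrAC [_^*%C * _]mulrC -sqr_normc normE expr2 -mulrA divff ?mulr1//.
  by rewrite -normE normr_eq0.
have := circle_mean_Re zeta eu; rewrite uf /= => <-.
have eG : entire (fun w => f (zeta * cexp w)).
  by apply: (entire_comp ef); apply: entireZ; exact: entire_cexp.
have cn : continuous (fun t => normc (f (zeta * cexp (0 +i* t)))).
  exact: (@continuous_vline_comp _ (@normc R) 0 eG continuous_normc).
have euG : entire (fun w => u * f (zeta * cexp w)) by exact: entireZ.
have cR : continuous (fun t => complex.Re (u * f (zeta * cexp (0 +i* t)))).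
  exact: (@continuous_vline_comp _ (@complex.Re R) 0 euG continuous_Re).
apply: le_Rintegral => //.
- exact: itvint_integrable cR.
- exact: itvint_integrable cn.
- move=> t _; apply: (le_trans (ler_norm _)).
  by rewrite (le_trans (ler_Re_normc _))// normcM nu mul1r.
Qed.

(** * Invariance of area under translations and rotations *)

Lemma measurable_translate (c : R) :
  measurable_fun setT (fun x : measurableTypeR R => x + c : measurableTypeR R).
Proof. exact: measurable_funD. Qed.

Lemma lebesgue_measure_translate (c : R) (A : set (measurableTypeR R)) :
  measurable A ->
  pushforward (@lebesgue_measure R)
    (fun x : measurableTypeR R => x + c : measurableTypeR R) A =
  lebesgue_measure A.
Proof.
move=> mA.
apply/esym; pose P : {measure set (measurableTypeR R) -> \bar R} :=
  measure_function_pushforward__canonical__measure_function_Measure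
    (@lebesgue_measure R) (measurable_translate c).
apply: (@lebesgue_measure_unique R P) => //= _ [[a b]] _ <-.
rewrite /P /= /pushforward.
have -> : (fun x : R => x + c) @^-1` `]a, b]%classic = `]a - c, b - c]%classic.
  by apply/seteqP; split => x /=; rewrite !in_itv /= ltrBlDr lerBrDr.
rewrite !lebesgue_measure_itv/= !lte_fin ltrD2r.
by case: ifPn => // _; rewrite -!EFinB; congr EFin; lra.
Qed.

Lemma ge0_integral_translate (c : R) (f : measurableTypeR R -> \bar R) :
  measurable_fun setT f -> (forall x, 0 <= f x)%E ->
  (\int[@lebesgue_measure R]_x f (x + c)%R = \int[@lebesgue_measure R]_x f x)%E.
Proof.
move=> mf f0.
have mt := measurable_translate c.
have := @ge0_integral_pushforward _ _ _ _ R _ mt (@lebesgue_measure R)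
  setT f measurableT mf.
rewrite preimage_setT => /(_ (fun x _ => f0 x)) /= <-.
by apply: eq_measure_integral => A mA _; exact: lebesgue_measure_translate.
Qed.

Notation leb2 := (@lebesgue_measure R \x @lebesgue_measure R)%E.
Notation R2 := (measurableTypeR R * measurableTypeR R)%type.

(** Stated with integrals of nonnegative functions, so that it can be obtained from
Tonelli's theorem and is stable under composition. *)
Definition preserves_area (psi : R2 -> R2) :=
  measurable_fun setT psi /\
  forall F : R2 -> \bar R, measurable_fun setT F -> (forall q, 0 <= F q)%E ->
    (\int[leb2]_q F (psi q) = \int[leb2]_q F q)%E.

Lemma preserves_area_comp psi phi : preserves_area psi -> preserves_area phi ->
  preserves_area (psi \o phi).
Proof.
move=> [mpsi Hpsi] [mphi Hphi]; split; first exact: measurableT_comp.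
move=> F mF F0; rewrite -(Hpsi F)//; apply: (Hphi (F \o psi)).
  exact: measurableT_comp.
by move=> q; exact: F0.
Qed.

(** Integrate first in the coordinate that is translated. *)
Lemma preserves_area_hshear (k : measurableTypeR R -> measurableTypeR R) :
  measurable_fun setT k ->
  preserves_area (fun q => (q.1 + k q.2, q.2) : R2).
Proof.
move=> mk.
have mpsi : measurable_fun setT (fun q : R2 => (q.1 + k q.2, q.2) : R2).
  apply/measurable_fun_pairP; split => /=; last exact: measurable_snd.
  apply: measurable_funD; first exact: measurable_fst.
  by apply: measurableT_comp => //; exact: measurable_snd.
split=> // F mF F0.
rewrite (fubini_tonelli2 F)//.
rewrite (fubini_tonelli2 (F \o fun q : R2 => (q.1 + k q.2, q.2) : R2)); last 2 first.
- exact: (measurableT_comp mF mpsi).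
- by move=> q; exact: F0.
apply: eq_integral => y _; rewrite /fubini_G /=.
apply: (@ge0_integral_translate (k y) (fun x => F (x, y))) => //.
exact: measurableT_comp.
Qed.

Lemma preserves_area_vshear (k : measurableTypeR R -> measurableTypeR R) :
  measurable_fun setT k ->
  preserves_area (fun q => (q.1, q.2 + k q.1) : R2).
Proof.
move=> mk.
have mpsi : measurable_fun setT (fun q : R2 => (q.1, q.2 + k q.1) : R2).
  apply/measurable_fun_pairP; split => /=; first exact: measurable_fst.
  apply: measurable_funD; first exact: measurable_snd.
  by apply: measurableT_comp => //; exact: measurable_fst.
split=> // F mF F0.
rewrite (fubini_tonelli1 F)//.
rewrite (fubini_tonelli1 (F \o fun q : R2 => (q.1, q.2 + k q.1) : R2)); last 2 first.
- exact: (measurableT_comp mF mpsi).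
- by move=> q; exact: F0.
apply: eq_integral => x _; rewrite /fubini_F /=.
apply: (@ge0_integral_translate (k x) (fun y => F (x, y))) => //.
exact: measurableT_comp.
Qed.

Lemma preserves_area_translation (a b : R) :
  preserves_area (fun q => (q.1 + a, q.2 + b) : R2).
Proof.
have H1 : preserves_area (fun q => (q.1 + a, q.2) : R2).
  exact: (@preserves_area_hshear (fun=> a)).
have H2 : preserves_area (fun q => (q.1, q.2 + b) : R2).
  exact: (@preserves_area_vshear (fun=> b)).
exact: preserves_area_comp H1 H2.
Qed.

(** A rotation of angle t is the product of a horizontal shear of slope -tan(t/2),
a vertical one of slope sin(t), and the first one again. In terms of
(c, s) = (cos t, sin t) the slope is -s / (1 + c); the half turn, for which it
is not defined, is the square of a quarter turn. *)
Lemma preserves_area_rotation (c s : R) : c ^+ 2 + s ^+ 2 = 1 ->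
  preserves_area (fun q => (c * q.1 - s * q.2, s * q.1 + c * q.2) : R2).
Proof.
have main (c' s' : R) : c' ^+ 2 + s' ^+ 2 = 1 -> c' != -1 ->
    preserves_area (fun q => (c' * q.1 - s' * q.2, s' * q.1 + c' * q.2) : R2).
  move=> cs c1; have d0 : 1 + c' != 0 by rewrite addrC addr_eq0.
  have ml (t : R) : measurable_fun setT
      (fun x : measurableTypeR R => t * x : measurableTypeR R) by exact: measurable_funM.
  pose k : R := - s' / (1 + c').
  have Hh := preserves_area_hshear (ml k).
  have Hv := preserves_area_vshear (ml s').
  suff -> : (fun q => (c' * q.1 - s' * q.2, s' * q.1 + c' * q.2) : R2) =
      (fun q => (q.1 + k * q.2, q.2) : R2) \o
      ((fun q => (q.1, q.2 + s' * q.1) : R2) \o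
      (fun q => (q.1 + k * q.2, q.2) : R2)).
    exact: preserves_area_comp Hh (preserves_area_comp Hv Hh).
  have ks : k * s' = c' - 1.
    rewrite /k mulrAC; apply: (mulIf d0); rewrite divfK//.
    lra.
  have k1 : k * (1 + c') = - s' by rewrite /k divfK.
  apply/funext => -[x y] /=; congr (_, _).
    transitivity (x + k * y + k * y + (k * s') * (x + k * y)); last by ring.
    rewrite ks; transitivity (c' * x + (k * (1 + c')) * y); last by ring.
    by rewrite k1; ring.
  transitivity (s' * x + y + (k * s') * y); last by ring.
  by rewrite ks; ring.
move=> cs; have [c1|] := eqVneq c (-1); last exact: main.
have s0 : s = 0.
  move: cs; rewrite c1 sqrrN expr1n => /(canRL (addKr _)).
  by rewrite addNr => /eqP; rewrite sqrf_eq0 => /eqP.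
have H : preserves_area (fun q => (0 * q.1 - 1 * q.2, 1 * q.1 + 0 * q.2) : R2).
  by apply: main; rewrite ?expr0n ?expr1n ?add0r// eq_sym oppr_eq0 oner_eq0.
have := preserves_area_comp H H; congr preserves_area.
by apply/funext => -[x y] /=; rewrite c1 s0; congr (_, _); ring.
Qed.

(** * Area measure on the complex plane *)

Lemma open_measurable_complex (U : set R[i]) : open U -> measurable U.
Proof. by move=> oU; exact: sub_sigma_algebra. Qed.

Lemma continuous_measurable_complex (g : R[i] -> R) : continuous g ->
  measurable_fun setT g.
Proof.
move=> cg; apply: (measurability _ (RGenOInfty.measurableE R)) => //.
move=> _ [_ [a ->] <-]; rewrite setTI; apply: open_measurable_complex.
by apply: open_comp; [move=> z _; exact: cg|exact: rray_open].
Qed.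

Lemma measurable_Re : measurable_fun setT (fun z : R[i] => complex.Re z).
Proof. exact: continuous_measurable_complex continuous_Re. Qed.

Lemma measurable_Im : measurable_fun setT (fun z : R[i] => complex.Im z).
Proof. exact: continuous_measurable_complex continuous_Im. Qed.

(** The Borel sets of the plane come from its topology, not from a product; this
reduces the measurability of a map into the plane to its two coordinates. *)
Lemma measurable_mk_complex d (T : measurableType d) (a b : T -> R) :
  measurable_fun setT a -> measurable_fun setT b ->
  measurable_fun setT (fun x => a x +i* b x : R[i]).
Proof.
move=> ma mb.
have mab : measurable_fun setT (fun x => (a x, b x) : R2) by exact/measurable_fun_pairP.
exact: (measurableT_comp (@measurable_complex_of_pair R) mab).
Qed.

Lemma entire_measurable_normc (f : R[i] -> R[i]) : entire f ->
  measurable_fun setT (fun z => normc (f z)).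
Proof.
move=> ef; apply: continuous_measurable_complex => z.
apply: (continuous_comp (f := f)); last exact: continuous_normc.
exact: entire_continuous.
Qed.

Lemma measurable_disc (z : R[i]) (r : R) : measurable (disc z r).
Proof.
have eB : entire (fun w => w - z).
  by apply: entireD; [exact: entire_id|exact: entire_cst].
have := entire_measurable_normc eB measurableT (measurable_itv `]-oo, r[).
by rewrite setTI; congr measurable; apply/seteqP; split => w /=; rewrite in_itv.
Qed.

Lemma ge0_integral_area (F : R[i] -> \bar R) : measurable_fun setT F ->
  (forall z, 0 <= F z)%E ->
  (\int[@area R]_z F z = \int[leb2]_q F (complex_of_pair q))%E.
Proof.
move=> mF F0.
by rewrite ge0_integral_pushforward//; exact: measurable_complex_of_pair.
Qed.

Lemma measurable_comp_complex_of_pair (F : R[i] -> \bar R) :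
  measurable_fun setT F -> measurable_fun setT (fun q : R2 => F (complex_of_pair q)).
Proof. by move=> mF; apply: (measurableT_comp mF); exact: measurable_complex_of_pair. Qed.

Lemma measurable_complex_mull (u : R[i]) : measurable_fun setT (fun z : R[i] => u * z).
Proof.
have mRe := measurable_Re; have mIm := measurable_Im.
case: u => c s.
have -> : (fun z : R[i] => (c +i* s) * z) = (fun z : R[i] =>
    (c * complex.Re z - s * complex.Im z) +i* (c * complex.Im z + s * complex.Re z)).
  by apply/funext => -[a b]; simpc.
apply: measurable_mk_complex.
- by apply: measurable_funB; apply: measurable_funM.
- by apply: measurable_funD; apply: measurable_funM.
Qed.

Lemma measurable_complex_addr (u : R[i]) : measurable_fun setT (fun z : R[i] => z + u).
Proof.
have mRe := measurable_Re; have mIm := measurable_Im.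
case: u => c s.
have -> : (fun z : R[i] => z + (c +i* s)) = (fun z : R[i] =>
    (complex.Re z + c) +i* (complex.Im z + s)) by apply/funext => -[a b]; simpc.
by apply: measurable_mk_complex; apply: measurable_funD.
Qed.

Lemma ge0_integral_area_rotation (u : R[i]) (F : R[i] -> \bar R) :
  normc u = 1 -> measurable_fun setT F -> (forall z, 0 <= F z)%E ->
  (\int[@area R]_z F (u * z)%R = \int[@area R]_z F z)%E.
Proof.
move=> u1 mF F0; rewrite ge0_integral_area//; last first.
  exact: (measurableT_comp mF (measurable_complex_mull u)).
rewrite ge0_integral_area//; case: u u1 => c s u1.
have cs : c ^+ 2 + s ^+ 2 = 1 by rewrite -normc_sqr u1 expr1n.
have [_ H] := preserves_area_rotation cs.
rewrite -(H _ (measurable_comp_complex_of_pair mF))//.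
apply: eq_integral => -[x y] _; rewrite /complex_of_pair /=; congr F; simpc.
by rewrite (addrC (s * x)).
Qed.

Lemma ge0_integral_area_translation (w : R[i]) (F : R[i] -> \bar R) :
  measurable_fun setT F -> (forall z, 0 <= F z)%E ->
  (\int[@area R]_z F (z + w)%R = \int[@area R]_z F z)%E.
Proof.
move=> mF F0; rewrite ge0_integral_area//; last first.
  exact: (measurableT_comp mF (measurable_complex_addr w)).
rewrite ge0_integral_area//; case: w => a b.
have [_ H] := preserves_area_translation a b.
rewrite -(H _ (measurable_comp_complex_of_pair mF))//.
Qed.

Lemma cover_disc (r : R) : 0 < r -> exists c : nat -> R[i],
  setT = \bigcup_n disc (c n) r.
Proof.
move=> r0; have s0 : 0 < r / 2 by rewrite divr_gt0.
pose g (ab : int * int) : R[i] := (ab.1%:~R * (r / 2)) +i* (ab.2%:~R * (r / 2)).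
exists (fun n => if unpickle n is Some ab then g ab else 0).
apply/seteqP; split=> // -[x y] _.
exists (pickle (Num.floor (x / (r / 2)), Num.floor (y / (r / 2)))) => //.
rewrite pickleK /disc /g /=; simpc.
have near (t : R) : `|t - (Num.floor (t / (r / 2)))%:~R * (r / 2)| < r / 2.
  have := Num.Theory.floor_le (t / (r / 2)).
  have := Num.Theory.lt_succ_floor (t / (r / 2)).
  rewrite ltr_pdivrMr// ler_pdivlMr// intrD mulrDl mul1r => H1 H2.
  by rewrite ger0_norm ?subr_ge0// ltrBlDl.
rewrite -[Num.sqrt _]/(normc ((x - _) +i* (y - _))).
apply: (le_lt_trans (normc_le_ReIm _ _)).
by have := near x; have := near y; lra.
Qed.

(** The growth condition on mu makes it sigma-finite, which Tonelli's theorem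
requires. *)
Lemma sigma_finite_disc (mu : {measure set R[i] -> \bar R}) (r : R) : 0 < r ->
  (forall z, (mu (disc z r) < +oo)%E) -> sigma_finite setT mu.
Proof.
move=> r0 H; have [c cT] := cover_disc r0.
by exists (fun n => disc (c n) r) => // n; split => //; exact: measurable_disc.
Qed.

Lemma lebesgue_measure_itvoo (a b : R) : a <= b ->
  (@lebesgue_measure R) `]a, b[%classic = (b - a)%:E.
Proof.
move=> ab; rewrite (lebesgue_measure_itv `]a, b[)/= lte_fin EFinB.
by case: ltgtP ab => //= ->; rewrite subee.
Qed.

Lemma area_disc_ge (z : R[i]) (d : R) : 0 <= d -> ((d ^+ 2)%:E <= area (disc z d))%E.
Proof.
move=> d0; case: z => a b.
pose Q : set R2 := `]a - d / 2, a + d / 2[%classic `*` `]b - d / 2, b + d / 2[%classic.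
have -> : (d ^+ 2)%:E = leb2 Q.
  rewrite /Q product_measure1E; [|exact: measurable_itv|exact: measurable_itv].
  rewrite [X in (X * _)%E]lebesgue_measure_itvoo; last by lra.
  rewrite [X in (_ * X)%E]lebesgue_measure_itvoo; last by lra.
  by rewrite -EFinM; congr EFin; field.
apply: le_measure; rewrite ?inE.
- by apply: measurableX; exact: measurable_itv.
- rewrite -[X in measurable X]setTI; apply: measurable_complex_of_pair => //.
  exact: measurable_disc.
move=> [x y] []; rewrite /= !in_itv /= => /andP[x1 x2] /andP[y1 y2].
rewrite /disc /complex_of_pair /=; simpc.
rewrite -[Num.sqrt _]/(normc ((x - a) +i* (y - b))).
apply: (le_lt_trans (normc_le_ReIm _ _)).
have : `|x - a| < d / 2 by rewrite ltr_norml; lra.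
have : `|y - b| < d / 2 by rewrite ltr_norml; lra.
lra.
Qed.

Lemma area_disc_le (z : R[i]) (d : R) : 0 <= d -> (area (disc z d) <= (4 * d ^+ 2)%:E)%E.
Proof.
move=> d0; case: z => a b.
pose Q : set R2 := `]a - d, a + d[%classic `*` `]b - d, b + d[%classic.
have -> : (4 * d ^+ 2)%:E = leb2 Q.
  rewrite /Q product_measure1E; [|exact: measurable_itv|exact: measurable_itv].
  rewrite [X in (X * _)%E]lebesgue_measure_itvoo; last by lra.
  rewrite [X in (_ * X)%E]lebesgue_measure_itvoo; last by lra.
  by rewrite -EFinM; congr EFin; field.
rewrite /area /pushforward; apply: le_measure; rewrite ?inE.
- rewrite -[X in measurable X]setTI; apply: measurable_complex_of_pair => //.
  exact: measurable_disc.
- by apply: measurableX; exact: measurable_itv.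
move=> [x y]; rewrite /disc /complex_of_pair /=; simpc.
rewrite -[Num.sqrt _]/(normc ((x - a) +i* (y - b))) => H.
have /= := le_lt_trans (ler_Re_normc _) H.
have /= := le_lt_trans (ler_Im_normc _) H.
rewrite !ltr_norml => /andP[? ?] /andP[? ?].
by split; rewrite /= in_itv /=; lra.
Qed.

Lemma area_sigma_finite : sigma_finite setT (@area R).
Proof.
apply: (@sigma_finite_disc _ 1) => // z.
by rewrite (le_lt_trans (area_disc_le z ler01))// ltry.
Qed.

HB.instance Definition _ :=
  Measure_isSigmaFinite.Build _ _ _ (@area R) area_sigma_finite.

(** * Sub-mean value inequalities on discs *)

Lemma integral_indic_mul d (T : measurableType d) (mu : {measure set T -> \bar R})
    (D : set T) (f : T -> R) :
  (\int[mu]_(x in D) (f x)%:E = \int[mu]_x (\1_D x * f x)%:E)%E.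
Proof.
rewrite integral_mkcond; apply: eq_integral => x _; rewrite /patch indicE.
by case: ifP => _; rewrite ?mul1r ?mul0r.
Qed.

Lemma cexp_imag (t : R) : cexp (0 +i* t) = cos t +i* sin t.
Proof. by rewrite /cexp /= expR0 !mul1r. Qed.

Lemma normc_cexp_imag (t : R) : normc (cexp (0 +i* t)) = 1.
Proof. by rewrite normc_cexp /= expR0. Qed.

(** Integrate over zeta in the disc the fact that |f(0)| is at most the mean of |f|
over the rotations of zeta; exchange the integrals; by rotation invariance all
rotations give the same integral over the disc. The exact factor is the area of
the disc, which is only bounded below by the area d^2 of an inscribed
square. *)
Lemma disc_submean_normc0 (f : R[i] -> R[i]) (d : R) : entire f -> 0 <= d ->
  ((d ^+ 2 * normc (f 0))%:E <= \int[@area R]_(w in disc 0%R d) (normc (f w))%:E)%E.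
Proof.
move=> ef d0; set D := disc 0 d.
have mD : measurable D by exact: measurable_disc.
have mf := entire_measurable_normc ef.
have pi2 : 0 < 2 * pi :> R by rewrite mulr_gt0// pi_gt0.
pose K (q : R[i] * measurableTypeR R) : R :=
  \1_D q.1 * (\1_(`[0, 2 * pi]%classic) q.2 * normc (f (q.1 * cexp (0 +i* q.2)))).
have K0 q : 0 <= K q.
  by rewrite /K !mulr_ge0// ?normc_ge0// indicE ler0n.
have mK : measurable_fun setT K.
  have m1 : measurable_fun setT (fun q : R[i] * measurableTypeR R => q.1).
    exact: measurable_fst.
  have m2 : measurable_fun setT (fun q : R[i] * measurableTypeR R => q.2).
    exact: measurable_snd.
  have mr : measurable_fun setT (fun q : R[i] * measurableTypeR R => complex.Re q.1).
    exact: (measurableT_comp measurable_Re m1).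
  have mi : measurable_fun setT (fun q : R[i] * measurableTypeR R => complex.Im q.1).
    exact: (measurableT_comp measurable_Im m1).
  have mc : measurable_fun setT (fun q : R[i] * measurableTypeR R => cos q.2).
    exact: (measurableT_comp (continuous_measurable_fun (@continuous_cos R)) m2).
  have ms : measurable_fun setT (fun q : R[i] * measurableTypeR R => sin q.2).
    exact: (measurableT_comp (continuous_measurable_fun (@continuous_sin R)) m2).
  have mrot : measurable_fun setT
      (fun q : R[i] * measurableTypeR R => q.1 * cexp (0 +i* q.2)).
    have -> : (fun q : R[i] * measurableTypeR R => q.1 * cexp (0 +i* q.2)) =
        (fun q => (complex.Re q.1 * cos q.2 - complex.Im q.1 * sin q.2) +i*
                  (complex.Re q.1 * sin q.2 + complex.Im q.1 * cos q.2)).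
      by apply/funext => -[[a b] t]; rewrite cexp_imag /=; simpc.
    by apply: measurable_mk_complex;
      [apply: measurable_funB|apply: measurable_funD]; exact: measurable_funM.
  apply: measurable_funM.
    by apply: (measurableT_comp _ m1); exact: measurable_indic.
  apply: measurable_funM; last exact: (measurableT_comp mf mrot).
  by apply: (measurableT_comp _ m2); exact: measurable_indic.
set X := (\int[_]_(_ in _) _)%E.
have X0 : (0 <= X)%E by apply: integral_ge0 => z _; rewrite lee_fin normc_ge0.
have rot (t : R) : (\int[@area R]_z (K (z, t))%:E =
    (\1_(`[0%R, 2 * pi]%classic : set R) t)%:E * X)%E.
  set u := cexp (0 +i* t).
  pose G (w : R[i]) : R := \1_D w * normc (f w).
  have mG : measurable_fun setT G.
    by apply: measurable_funM => //; exact: measurable_indic.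
  have G0 w : 0 <= G w by rewrite /G mulr_ge0// ?normc_ge0// indicE ler0n.
  have KE z : K (z, t) = \1_(`[0, 2 * pi]%classic) t * G (u * z).
    rewrite /K /G /= mulrCA (mulrC u); congr (_ * (_ * _)).
    rewrite !indicE; congr (nat_of_bool _)%:R.
    apply/idP/idP; rewrite !inE /D /disc /= !subr0 normcM normc_cexp_imag mulr1//.
  under eq_integral do rewrite KE EFinM.
  rewrite ge0_integralZl_EFin//; last 2 first.
  - by move=> z _; rewrite lee_fin.
  - apply/measurable_EFinP; exact: (measurableT_comp mG (measurable_complex_mull u)).
  congr (_ * _)%E; rewrite (@ge0_integral_area_rotation u (EFin \o G)) ?normc_cexp_imag//.
  - by rewrite /X (integral_indic_mul (@area R) D); apply: eq_integral.
  - exact/measurable_EFinP.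
have mean (z : R[i]) : ((\1_D z * (normc (f 0) * (2 * pi)))%:E <=
    \int[@lebesgue_measure R]_t (K (z, t))%:E)%E.
  have eG : entire (fun w => f (z * cexp w)).
    by apply: (entire_comp ef); apply: entireZ; exact: entire_cexp.
  have cn : continuous (fun t => normc (f (z * cexp (0 +i* t)))).
    exact: (@continuous_vline_comp _ (@normc R) 0 eG continuous_normc).
  rewrite /K /=; under eq_integral do rewrite EFinM.
  rewrite ge0_integralZl_EFin//; last 2 first.
  - by move=> t _; rewrite lee_fin mulr_ge0// ?normc_ge0// indicE ler0n.
  - apply/measurable_EFinP; apply: measurable_funM; first exact: measurable_indic.
    exact: continuous_measurable_fun.
  rewrite -integral_indic_mul EFinM lee_wpmul2l// ?lee_fin ?indicE//.
  have := circle_mean_normc z ef; rewrite -lee_fin /itvint /Rintegral fineK//.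
  exact: integrable_fin_num (itvint_integrable _ _ cn).
have tonelli := @fubini_tonelli _ _ _ _ R (@area R) (@lebesgue_measure R) (EFin \o K).
have {}tonelli : (\int[@area R]_z \int[@lebesgue_measure R]_t (K (z, t))%:E =
    \int[@lebesgue_measure R]_t \int[@area R]_z (K (z, t))%:E)%E.
  by apply: tonelli; [exact/measurable_EFinP|move=> q; rewrite lee_fin].
move: tonelli; under [in RHS]eq_integral do rewrite rot.
have [->|Xfin] := eqVneq X +oo%E; first by rewrite leey.
have {}Xfin : X \is a fin_num by rewrite ge0_fin_numE// lt_neqAle Xfin leey.
rewrite -(fineK Xfin); under [in RHS]eq_integral do rewrite -EFinM mulrC.
set x := fine X; have x0 : 0 <= x by exact: fine_ge0.
under [in RHS]eq_integral do rewrite EFinM.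
rewrite ge0_integralZl_EFin//; last first.
  by apply/measurable_EFinP; exact: measurable_indic.
have lebI : (@lebesgue_measure R) `[0, 2 * pi]%classic = (2 * pi)%:E.
  by rewrite (lebesgue_measure_itv `[0, 2 * pi])/= lte_fin pi2 oppr0 adde0.
rewrite integral_indic// setIT [X in (_ * X)%E]lebI -EFinM.
move=> tonelli.
have : (\int[@area R]_z (\1_D z * (normc (f 0) * (2 * pi)))%:E <= (x * (2 * pi))%:E)%E.
  rewrite -tonelli; apply: ge0_le_integral => //.
  - move=> z _; rewrite lee_fin indicE mulr_ge0//.
    by rewrite mulr_ge0 ?normc_ge0// ltW.
  - by apply/measurable_EFinP; apply: measurable_funM => //; exact: measurable_indic.
  - apply: (@measurable_fun_fubini_tonelli_F _ _ _ _ _ (@lebesgue_measure R) (EFin \o K)).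
      exact/measurable_EFinP.
    by move=> q; rewrite lee_fin.
under eq_integral do rewrite mulrC EFinM.
rewrite ge0_integralZl_EFin//; last 2 first.
- by apply/measurable_EFinP; exact: measurable_indic.
- by rewrite mulr_ge0// ?normc_ge0// ltW.
rewrite integral_indic// setIT => H.
have : ((normc (f 0) * (2 * pi))%:E * (d ^+ 2)%:E <= (x * (2 * pi))%:E)%E.
  apply: le_trans H; rewrite lee_wpmul2l ?area_disc_ge// lee_fin.
  by rewrite mulr_ge0// ?normc_ge0// ltW.
by rewrite -EFinM !lee_fin mulrAC ler_pM2r// mulrC.
Qed.

Lemma ge0_integral_disc_translation (z : R[i]) (d : R) (g : R[i] -> R) :
  measurable_fun setT g -> (forall w, 0 <= g w) ->
  (\int[@area R]_(w in disc 0%R d) (g (w + z)%R)%:E =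
   \int[@area R]_(w in disc z d) (g w)%:E)%E.
Proof.
move=> mg g0; rewrite (integral_indic_mul (@area R) (disc z d)).
rewrite -(@ge0_integral_area_translation z (fun w => (\1_(disc z d) w * g w)%:E)).
- rewrite (integral_indic_mul (@area R)); apply: eq_integral => w _.
  congr (_ * _)%:E; rewrite !indicE; congr (nat_of_bool _)%:R.
  by apply/idP/idP; rewrite !inE /disc /= subr0 addrK.
- apply/measurable_EFinP; apply: measurable_funM => //.
  by apply: measurable_indic; exact: measurable_disc.
- by move=> w; rewrite lee_fin mulr_ge0// indicE.
Qed.

Lemma disc_submean_normc (f : R[i] -> R[i]) (z : R[i]) (d : R) : entire f -> 0 <= d ->
  ((d ^+ 2 * normc (f z))%:E <=
   \int[@area R]_(w in disc z d) (normc (f w))%:E)%E.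
Proof.
move=> ef d0; have eF : entire (fun w => f (w + z)).
  by apply: (entire_comp ef); apply: entireD; [exact: entire_id|exact: entire_cst].
have := disc_submean_normc0 eF d0; rewrite add0r => /le_trans; apply.
rewrite (@ge0_integral_disc_translation z d (fun w => normc (f w)))//.
- exact: entire_measurable_normc.
- by move=> w; exact: normc_ge0.
Qed.

Lemma continuous_complex_of_pair : continuous (fun q : R * R => q.1 +i* q.2 : R[i]).
Proof.
move=> q.
have -> : (fun q : R * R => q.1 +i* q.2) = (fun q => (q.1 +i* 0) + (0 +i* q.2)).
  by apply/funext => -[x y] /=; simpc.
apply: cvgD.
  by apply: (cvg_comp fst (fun x : R => x +i* 0)); [exact: cvg_fst|exact: continuous_hline].
by apply: (cvg_comp snd (fun y : R => 0 +i* y)); [exact: cvg_snd|exact: continuous_vline].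
Qed.

Lemma entire_bounded_disc (f : R[i] -> R[i]) (z : R[i]) (d : R) : entire f ->
  exists M : R, forall w, disc z d w -> normc (f w) <= M.
Proof.
move=> ef; case: z => a b.
pose K : set (R * R) := `[a - d, a + d]%classic `*` `[b - d, b + d]%classic.
have cK : compact K by apply: compact_setX; exact: segment_compact.
pose h (q : R * R) : R := normc (f (q.1 +i* q.2)).
have ch : continuous h.
  move=> q; apply: (continuous_comp (f := fun q : R * R => f (q.1 +i* q.2)));
    last exact: continuous_normc.
  apply: (continuous_comp (f := fun q : R * R => q.1 +i* q.2)).
    exact: continuous_complex_of_pair.
  exact: entire_continuous.
have /compact_bounded[M [_ HM]] : compact (h @` K).
  by apply: continuous_compact => //; exact: continuous_subspaceT.
exists (M + 1) => -[x y]; rewrite /disc /= => H.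
have := ler_Re_normc ((x +i* y) - (a +i* b)).
have := ler_Im_normc ((x +i* y) - (a +i* b)).
rewrite /= => /le_lt_trans/(_ H) Hy /le_lt_trans/(_ H) Hx.
move: Hx Hy; rewrite !ltr_norml => /andP[? ?] /andP[? ?].
have : `|h (x, y)| <= M + 1.
  apply: HM; first by rewrite ltrDl.
  by exists (x, y) => //; split; rewrite /= in_itv /=; lra.
by rewrite ger0_norm ?normc_ge0.
Qed.

Lemma entire_measurable_powR (g : R[i] -> R[i]) (q : R) : entire g ->
  measurable_fun setT (fun z => normc (g z) `^ q).
Proof.
move=> eg; apply: (measurableT_comp (measurable_powR q)).
exact: entire_measurable_normc.
Qed.

(** Let u = |g|^q and let S be the supremum of (d - |w - a|)^2 u(w) over the disc.
Choose z0 where at least S / 2 is reached, and let t be its distance to the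
circle. On the disc of centre z0 and radius t / 2, |g| is at most
N = (4 S / t^2)^(1/q), so that |g| <= N^(1 - q) u there, while |g(z0)| is at
least N / 8^(1/q). The inequality for |g| on this smaller disc then bounds S by
8^(1/q) times the integral of u. *)
Lemma disc_submean_powR_le1 (g : R[i] -> R[i]) (a : R[i]) (d q : R) : entire g ->
  0 < q -> q <= 1 -> 0 < d ->
  ((d ^+ 2 * normc (g a) `^ q)%:E <=
   (8 `^ q^-1)%:E * \int[@area R]_(w in disc a d) (normc (g w) `^ q)%:E)%E.
Proof.
move=> eg q0 q1 d0.
have qi0 : 0 <= q^-1 by rewrite invr_ge0 ltW.
set I := (\int[_]_(_ in _) _)%E.
have I0 : (0 <= I)%E by apply: integral_ge0 => w _; rewrite lee_fin powR_ge0.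
have [I_oo|Ifin] := eqVneq I +oo%E.
  by rewrite I_oo mulry gtr0_sg ?powR_gt0// mul1e leey.
have {}Ifin : I \is a fin_num by rewrite ge0_fin_numE// lt_neqAle Ifin leey.
pose u w := normc (g w) `^ q.
have u0 w : 0 <= u w by exact: powR_ge0.
pose E := [set (d - normc (w - a)) ^+ 2 * u w | w in disc a d].
have [M HM] := entire_bounded_disc a d eg.
have hsE : has_sup E.
  split.
    by exists ((d - normc (a - a)) ^+ 2 * u a), a; rewrite // /disc /= subrr normc0.
  exists (d ^+ 2 * M `^ q) => _ [w Dw <-]; apply: ler_pM; rewrite ?sqr_ge0//.
    rewrite ler_pXn2r ?nnegrE ?subr_ge0 ?(ltW d0)//; first by rewrite gerBl normc_ge0.
    exact: ltW.
  apply: ge0_ler_powR; rewrite ?nnegrE ?(ltW q0) ?normc_ge0 ?HM//.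
  by rewrite (le_trans _ (HM _ Dw)) ?normc_ge0.
set S := sup E.
have aS : d ^+ 2 * u a <= S.
  apply: ub_le_sup; first by case: hsE.
  by exists a; rewrite /disc /= subrr normc0 ?subr0.
suff SI : (S%:E <= (8 `^ q^-1)%:E * I)%E by rewrite (le_trans _ SI)// lee_fin.
have [S0|S0] := leP S 0.
  by rewrite (@le_trans _ _ 0%E) ?lee_fin// mule_ge0// lee_fin powR_ge0.
have [_ [z0 Dz0 <-]] := sup_adherent (divr_gt0 S0 (ltr0n R 2)) hsE.
rewrite -/S; set t := d - normc (z0 - a) => St.
have t0 : 0 < t by rewrite subr_gt0.
have Dsub w : disc z0 (t / 2) w -> disc a d w /\ t / 2 <= d - normc (w - a).
  rewrite /disc /= => H; have := normcD (w - z0) (z0 - a).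
  by move: t0; rewrite addrA subrK /t in H * => t0 H'; split; lra.
pose N := (4 * S / t ^+ 2) `^ q^-1.
have B0 : 0 < 4 * S / t ^+ 2 by rewrite divr_gt0 ?mulr_gt0 ?exprn_gt0.
have N0 : 0 < N by exact: powR_gt0.
have Nq : N `^ q = 4 * S / t ^+ 2.
  by rewrite /N -powRrM mulVf ?gt_eqF// powRr1 ?ltW.
have uN w : disc z0 (t / 2) w -> normc (g w) <= N.
  move=> /Dsub[Dw tw].
  have H : (t / 2) ^+ 2 * u w <= S.
    apply: (@le_trans _ _ ((d - normc (w - a)) ^+ 2 * u w)).
      rewrite ler_wpM2r// ler_pXn2r ?nnegrE//;
        by rewrite ?(le_trans _ tw)// divr_ge0 ?ltW.
    by apply: ub_le_sup; [case: hsE|exists w].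
  have -> : normc (g w) = u w `^ q^-1.
    by rewrite /u -powRrM mulfV ?gt_eqF// powRr1 ?normc_ge0.
  rewrite /N; apply: ge0_ler_powR; rewrite ?nnegrE ?(ltW B0)//.
  by rewrite ler_pdivlMr ?exprn_gt0//; rewrite expr_div_n in H; lra.
have split_pow w : disc z0 (t / 2) w -> normc (g w) <= N `^ (1 - q) * u w.
  move=> Dw; have -> : normc (g w) = normc (g w) `^ (1 - q) * u w.
    by rewrite /u -powRD ?subrK ?oner_eq0// powRr1 ?normc_ge0.
  rewrite ler_wpM2r//; apply: ge0_ler_powR;
    rewrite ?nnegrE ?normc_ge0 ?subr_ge0 ?(ltW N0)//.
  exact: uN.
have gz0 : N * (8 `^ q^-1)^-1 <= normc (g z0).
  have -> : normc (g z0) = u z0 `^ q^-1.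
    by rewrite /u -powRrM mulfV ?gt_eqF// powRr1 ?normc_ge0.
  have -> : N * (8 `^ q^-1)^-1 = (4 * S / t ^+ 2 / 8) `^ q^-1.
    rewrite powRM ?(ltW B0)//; congr (_ * _).
    by rewrite -powR_inv1 ?powR_ge0// -(powR_inv1 (ler0n R 8)) -!powRrM mulrC.
  apply: ge0_ler_powR; rewrite ?nnegrE//.
    by rewrite divr_ge0 ?(ltW B0).
  by rewrite -mulrA -invfM ler_pdivrMr ?mulr_gt0 ?exprn_gt0//; lra.
have mpow : measurable_fun setT u by exact: entire_measurable_powR.
have mD := measurable_disc z0 (t / 2).
have main : (((t / 2) ^+ 2 * normc (g z0))%:E <= (N `^ (1 - q))%:E * I)%E.
  apply: (le_trans (disc_submean_normc z0 eg _)); first by rewrite divr_ge0 ?ltW.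
  apply: (@le_trans _ _ (\int[@area R]_(w in disc z0 (t / 2))
      ((N `^ (1 - q))%:E * (u w)%:E))%E).
    apply: ge0_le_integral => //.
    - by move=> w _; rewrite lee_fin normc_ge0.
    - apply/measurable_EFinP; apply: measurable_funTS; exact: entire_measurable_normc.
    - apply: measurable_funeM; apply/measurable_EFinP; exact: measurable_funTS.
  rewrite ge0_integralZl_EFin ?powR_ge0//; last 2 first.
  - by move=> w _; rewrite lee_fin.
  - by apply/measurable_EFinP; exact: measurable_funTS.
  rewrite lee_wpmul2l ?lee_fin ?powR_ge0//.
  apply: ge0_subset_integral => //.
  - exact: measurable_disc.
  - by apply/measurable_EFinP; exact: measurable_funTS.
  - by move=> w _; rewrite lee_fin.
  - by move=> w /Dsub[].
move: main; rewrite -(fineK Ifin) -!EFinM !lee_fin.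
set i := fine I => main.
have P8 : 0 < 8 `^ q^-1 :> R by exact: powR_gt0.
have NE : N = N `^ (1 - q) * N `^ q.
  by rewrite -powRD ?subrK ?oner_eq0// powRr1 ?ltW.
have N1 : 0 < N `^ (1 - q) by exact: powR_gt0.
have H1 : (t / 2) ^+ 2 * (N * (8 `^ q^-1)^-1) <= N `^ (1 - q) * i.
  by apply: le_trans main; rewrite ler_wpM2l// sqr_ge0.
have t2 : t ^+ 2 != 0 by rewrite gt_eqF ?exprn_gt0.
have E1 : (t / 2) ^+ 2 * (N * (8 `^ q^-1)^-1) = N `^ (1 - q) * (S / (8 `^ q^-1)).
  rewrite [in LHS]NE Nq expr_div_n.
  have -> : (2 ^+ 2 : R) = 4 by lra.
  by field; rewrite gt_eqF ?gt_eqF//=.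
by rewrite E1 ler_pM2l// ler_pdivrMr// mulrC in H1.
Qed.

(** With k >= p, apply the case of exponent p / k <= 1 to g^k. *)
Lemma disc_submean_powR (p : R) : 0 < p -> exists2 C : R, 0 < C &
  forall (g : R[i] -> R[i]) (a : R[i]) (d : R), entire g -> 0 < d ->
  ((d ^+ 2 * normc (g a) `^ p)%:E <=
   C%:E * \int[@area R]_(w in disc a d) (normc (g w) `^ p)%:E)%E.
Proof.
move=> p0; pose k := (Num.bound p).+1.
have pk : p <= k%:R.
  by rewrite (le_trans (ltW (archi_boundP (ltW p0))))// ler_nat /k.
have k0 : 0 < k%:R :> R by rewrite ltr0n.
exists (8 `^ (p / k%:R)^-1); first by rewrite powR_gt0.
move=> g a d eg d0.
have powE w : normc (g w) `^ p = normc (g w ^+ k) `^ (p / k%:R).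
  by rewrite normcX -powR_mulrn ?normc_ge0// -powRrM mulrCA mulfV ?mulr1// gt_eqF.
rewrite powE; under eq_integral do rewrite powE.
have egk : entire (fun w => g w ^+ k) by exact: entireX.
have q0 : 0 < p / k%:R by rewrite divr_gt0.
have q1 : p / k%:R <= 1 by rewrite ler_pdivrMr// mul1r.
exact: (@disc_submean_powR_le1 (fun w => g w ^+ k) a d _ egk q0 q1 d0).
Qed.

(** * The local estimate for the Gaussian weight *)

Lemma fock_weightE (f : R[i] -> R[i]) (p : R) (z : R[i]) :
  fock_weight f p z = normc (f z) `^ p * expR (- (p / 2 * normc z ^+ 2)).
Proof.
rewrite /fock_weight normcM powRM ?normc_ge0//; congr (_ * _).
by rewrite normc_real ger0_norm ?expR_ge0// -expRM; congr expR; field.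
Qed.

Lemma fock_weight_ge0 (f : R[i] -> R[i]) (p : R) (z : R[i]) : 0 <= fock_weight f p z.
Proof. exact: powR_ge0. Qed.

Lemma measurable_fock_weight (f : R[i] -> R[i]) (p : R) : entire f ->
  measurable_fun setT (fock_weight f p).
Proof.
move=> ef; rewrite (funext (fock_weightE f p)).
apply: measurable_funM; first exact: entire_measurable_powR.
apply: (measurableT_comp (@measurable_expR R)).
apply: measurableT_comp => //; apply: measurable_funM => //.
apply: measurable_funX; exact: (entire_measurable_normc entire_id).
Qed.

Lemma normc_sqrB (z w : R[i]) : normc (w - z) ^+ 2 =
  normc w ^+ 2 - 2 * complex.Re (z^*%C * w) + normc z ^+ 2.
Proof. by case: z w => a b [c d]; simpc; rewrite !normc_sqr /=; ring. Qed.

(** By [normc_sqrB], |f(w) exp(- conj(z) w)|^p is the weight of f at w times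
exp(p |w - z|^2 / 2) up to a factor depending on z only: the Gaussian is now
centred at z and bounded on the disc. *)
Lemma fock_weight_disc_le (p : R) : 0 < p -> exists2 C : R, 0 < C &
  forall (f : R[i] -> R[i]) (z : R[i]) (d : R), entire f -> 0 < d ->
  ((d ^+ 2 * fock_weight f p z)%:E <=
   (C * expR (p / 2 * d ^+ 2))%:E *
     \int[@area R]_(w in disc z d) (fock_weight f p w)%:E)%E.
Proof.
move=> p0; have [C C0 HC] := disc_submean_powR p0.
exists C => // f z d ef d0.
pose g w := f w * cexp (- z^*%C * w).
have eg : entire g.
  apply: entireM; first exact: ef.
  by apply: (entire_comp entire_cexp); apply: entireZ; exact: entire_id.
have gE w : normc (g w) `^ p =
    fock_weight f p w * expR (p / 2 * normc (w - z) ^+ 2) *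
    expR (- (p / 2 * normc z ^+ 2)).
  rewrite fock_weightE /g normcM powRM ?normc_ge0// normc_cexp -expRM -!mulrA.
  congr (_ * _).
  rewrite -!expRD normc_sqrB mulNr; congr expR.
  by case: (z^*%C * w) => x y /=; field.
have := HC g z d eg d0; rewrite gE subrr normc0 expr0n mulr0 expR0 mulr1.
set c := expR (- _) in gE *; have c0 : 0 < c by exact: expR_gt0.
move=> H; rewrite -(@lee_pmul2r _ c%:E) ?lte_fin//.
rewrite -EFinM -(mulrA (d ^+ 2)); apply: le_trans H _.
rewrite EFinM -!muleA lee_wpmul2l ?lee_fin ?(ltW C0)//.
have mw : measurable_fun (disc z d) (EFin \o fock_weight f p).
  by apply/measurable_EFinP; apply: measurable_funTS; exact: measurable_fock_weight.
have mD := measurable_disc z d.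
apply: (@le_trans _ _ (\int[@area R]_(w in disc z d)
    ((expR (p / 2 * d ^+ 2) * c)%:E * (fock_weight f p w)%:E))%E).
  apply: ge0_le_integral => //.
  - by move=> w _; rewrite lee_fin powR_ge0.
  - by apply/measurable_EFinP; apply: measurable_funTS; exact: entire_measurable_powR.
  - exact: measurable_funeM.
  - move=> w Dw; rewrite -EFinM lee_fin gE.
    have : expR (p / 2 * normc (w - z) ^+ 2) <= expR (p / 2 * d ^+ 2).
      rewrite ler_expR ler_wpM2l ?divr_ge0 ?(ltW p0)//.
      by rewrite ler_pXn2r ?nnegrE ?normc_ge0 ?(ltW d0)// ltW.
    set e1 := expR _; set e2 := expR _; set x := fock_weight f p w => e12.
    rewrite (_ : x * e1 * c = c * x * e1); last by ring.
    rewrite (_ : e2 * c * x = c * x * e2); last by ring.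
    by rewrite ler_wpM2l// mulr_ge0 ?(ltW c0)// fock_weight_ge0.
rewrite ge0_integralZl_EFin//.
- by rewrite EFinM -!muleA lee_wpmul2l ?lee_fin ?expR_ge0// muleC.
- by move=> w _; rewrite lee_fin fock_weight_ge0.
- by rewrite mulr_ge0 ?expR_ge0 ?(ltW c0).
Qed.

(** * Averaging over discs, and Tonelli's theorem *)

Lemma measurable_disc_kernel (r : R) (phi : R[i] -> R) : measurable_fun setT phi ->
  measurable_fun setT (fun q : R[i] * R[i] => \1_(disc q.1 r) q.2 * phi q.2).
Proof.
move=> mphi; pose near (q : R[i] * R[i]) := normc (q.2 - q.1).
have mnear : measurable_fun setT near.
  have mRe1 := measurableT_comp measurable_Re (@measurable_fst _ _ R[i] R[i]).
  have mRe2 := measurableT_comp measurable_Re (@measurable_snd _ _ R[i] R[i]).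
  have mIm1 := measurableT_comp measurable_Im (@measurable_fst _ _ R[i] R[i]).
  have mIm2 := measurableT_comp measurable_Im (@measurable_snd _ _ R[i] R[i]).
  have -> : near = (@normc R) \o (fun q : R[i] * R[i] =>
      (complex.Re q.2 - complex.Re q.1) +i* (complex.Im q.2 - complex.Im q.1)).
    by apply/funext => -[[a b] [c d]]; rewrite /near /=; simpc.
  apply: measurableT_comp; first exact: continuous_measurable_complex continuous_normc.
  by apply: measurable_mk_complex; exact: measurable_funB.
pose B := [set q | near q < r].
have mB : measurable B.
  have := mnear measurableT _ (measurable_itv `]-oo, r[).
  by rewrite setTI; congr measurable; apply/seteqP; split => w /=; rewrite in_itv.
have -> : (fun q : R[i] * R[i] => \1_(disc q.1 r) q.2 * phi q.2) =
    (fun q => \1_B q * phi q.2).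
  by apply/funext => q; rewrite !indicE; congr (_%:R * _); apply/idP/idP; rewrite !inE.
apply: measurable_funM; first exact: measurable_indic.
exact: (measurableT_comp mphi (@measurable_snd _ _ _ _)).
Qed.

Lemma measurable_disc_integral (nu : {sigma_finite_measure set R[i] -> \bar R})
    (r : R) (phi : R[i] -> R) : measurable_fun setT phi -> (forall z, 0 <= phi z) ->
  measurable_fun setT (fun z => \int[nu]_(w in disc z r) (phi w)%:E)%E.
Proof.
move=> mphi phi0.
have -> : (fun z => \int[nu]_(w in disc z r) (phi w)%:E)%E =
    (fun z => \int[nu]_w (\1_(disc z r) w * phi w)%:E)%E.
  by apply/funext => z; exact: integral_indic_mul.
apply: (@measurable_fun_fubini_tonelli_F _ _ _ _ _ nu
  (fun q : R[i] * R[i] => (\1_(disc q.1 r) q.2 * phi q.2)%:E)).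
  by apply/measurable_EFinP; exact: measurable_disc_kernel.
by move=> q; rewrite lee_fin mulr_ge0// indicE.
Qed.

Lemma measurable_mass_disc (nu : {sigma_finite_measure set R[i] -> \bar R}) (r : R) :
  measurable_fun setT (fun z => nu (disc z r)).
Proof.
have -> : (fun z => nu (disc z r)) = (fun z => \int[nu]_(w in disc z r) 1%:E)%E.
  by apply/funext => z; rewrite integral_cst ?mul1e//; exact: measurable_disc.
exact: (@measurable_disc_integral nu r (cst 1)).
Qed.

(** The condition |w - z| < r is symmetric in z and w. *)
Lemma integral_disc_integral (nu : {sigma_finite_measure set R[i] -> \bar R}) (r : R)
    (phi : R[i] -> R) : measurable_fun setT phi -> (forall z, 0 <= phi z) ->
  (\int[nu]_z \int[@area R]_(w in disc z r) (phi w)%:E =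
   \int[@area R]_w ((phi w)%:E * nu (disc w r)))%E.
Proof.
move=> mphi phi0.
pose H (q : R[i] * R[i]) : R := \1_(disc q.1 r) q.2 * phi q.2.
have tonelli := @fubini_tonelli _ _ _ _ R nu (@area R) (EFin \o H).
have {}tonelli : (\int[nu]_z \int[@area R]_w (H (z, w))%:E =
    \int[@area R]_w \int[nu]_z (H (z, w))%:E)%E.
  apply: tonelli; first by apply/measurable_EFinP; exact: measurable_disc_kernel.
  by move=> q; rewrite lee_fin mulr_ge0// indicE.
transitivity (\int[nu]_z \int[@area R]_w (H (z, w))%:E)%E.
  by apply: eq_integral => z _; rewrite (integral_indic_mul (@area R)).
rewrite tonelli; apply: eq_integral => w _.
have HE z : H (z, w) = phi w * \1_(disc w r) z.
  rewrite /H /= mulrC !indicE; congr (_ * (nat_of_bool _)%:R).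
  by apply/idP/idP; rewrite !inE /disc /= normc_distC.
under eq_integral do rewrite HE EFinM.
rewrite ge0_integralZl_EFin//.
- by rewrite integral_indic ?setIT//; exact: measurable_disc.
- by apply/measurable_EFinP; apply: measurable_indic; exact: measurable_disc.
Qed.

(** * Comparison of the weights 1 + |z| and |z| *)

Lemma measurable_normc : measurable_fun setT (fun z : R[i] => normc z).
Proof. exact: (entire_measurable_normc entire_id). Qed.

Lemma fock_weight_disc_fin_num (f : R[i] -> R[i]) (p : R) (z : R[i]) (d : R) :
  entire f -> 0 < p -> 0 <= d ->
  (\int[@area R]_(w in disc z d) (fock_weight f p w)%:E)%E \is a fin_num.
Proof.
move=> ef p0 d0; have [M HM] := entire_bounded_disc z d ef.
have mD := measurable_disc z d.
rewrite ge0_fin_numE; last first.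
  by apply: integral_ge0 => w _; rewrite lee_fin fock_weight_ge0.
rewrite (@le_lt_trans _ _ (\int[@area R]_(w in disc z d) cst (M `^ p)%:E w)%E)//.
  apply: ge0_le_integral => //.
  - by move=> w _; rewrite lee_fin fock_weight_ge0.
  - by apply/measurable_EFinP; apply: measurable_funTS; exact: measurable_fock_weight.
  - move=> w Dw; rewrite lee_fin fock_weightE -[leRHS]mulr1.
    have gM := HM _ Dw; have M0 : 0 <= M := le_trans (normc_ge0 _) gM.
    apply: ler_pM; rewrite ?powR_ge0 ?expR_ge0//.
      by apply: ge0_ler_powR; rewrite ?nnegrE ?normc_ge0 ?(ltW p0).
    by rewrite expR_le1 oppr_le0 mulr_ge0 ?sqr_ge0 ?divr_ge0 ?(ltW p0).
rewrite integral_cst// lte_mul_pinfty ?lee_fin ?powR_ge0//.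
by rewrite (le_lt_trans (area_disc_le z d0))// ltry.
Qed.

(** By the local estimate on discs of radius 1/2, the weight is at most B times X on
the disc of radius 1/2, where X is its integral over the unit disc; a disc of
area at most 1 / (2 B) thus carries at most X / 2. *)
Lemma fock_weight_small_disc (p : R) : 0 < p -> exists2 e : R, 0 < e <= 2^-1 &
  forall f : R[i] -> R[i], entire f ->
  (\int[@area R]_(w in disc 0%R e) (fock_weight f p w)%:E <=
   (2^-1)%:E * \int[@area R]_(w in disc 0%R 1) (fock_weight f p w)%:E)%E.
Proof.
move=> p0; have [A A0 HA] := fock_weight_disc_le p0.
have h0 : 0 < 2^-1 :> R by rewrite invr_gt0.
set E := expR (p / 2 * 2^-1 ^+ 2); have E0 : 0 < E by exact: expR_gt0.
pose B := 4 * (A * E).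
have B0 : 0 < B by rewrite !mulr_gt0.
have B1 : 0 < 8 * (B + 1) by rewrite mulr_gt0// addr_gt0.
pose e := Num.min 2^-1 (8 * (B + 1))^-1.
have e0 : 0 < e by rewrite lt_min h0 invr_gt0 B1.
have e2 : e <= 2^-1 by rewrite ge_min lexx.
have eB : 4 * e ^+ 2 * B <= 2^-1.
  have H : e * (8 * (B + 1)) <= 1.
    by rewrite -ler_pdivlMr// div1r ge_min lexx orbT.
  have ee : e ^+ 2 <= e by rewrite expr2 ler_piMr ?(ltW e0)//; lra.
  have : 4 * e ^+ 2 * B <= 4 * e * B by rewrite ler_wpM2r ?(ltW B0)// ler_wpM2l.
  lra.
exists e; first by rewrite e0.
move=> f ef; set Z := (X in (X <= _)%E); set X := integral _ _ _ in |- *.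
have X0 : (0 <= X)%E by apply: integral_ge0 => z _; rewrite lee_fin fock_weight_ge0.
have Xfin : X \is a fin_num by exact: fock_weight_disc_fin_num.
have mD := measurable_disc 0 e.
have mphiD D' : measurable_fun D' (EFin \o fock_weight f p).
  by apply/measurable_EFinP; apply: measurable_funTS; exact: measurable_fock_weight.
apply: (@le_trans _ _ (\int[@area R]_(z in disc 0%R e) cst (B * fine X)%:E z)%E).
  apply: ge0_le_integral => //.
  - by move=> z _; rewrite lee_fin fock_weight_ge0.
  - move=> z Dz; have H1 := HA f z 2^-1 ef h0.
    have sub : disc z 2^-1 `<=` disc 0 1.
      move=> w; rewrite /disc /= subr0 => wz.
      have := normcD (w - z) z; rewrite subrK.
      by move: Dz; rewrite /disc /= subr0; lra.
    have H2 : ((A * E)%:E * \int[@area R]_(w in disc z 2^-1) (fock_weight f p w)%:E <=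
        (A * E)%:E * X)%E.
      rewrite lee_wpmul2l ?lee_fin ?(ltW (mulr_gt0 A0 E0))//.
      apply: ge0_subset_integral => //; [exact: measurable_disc|exact: measurable_disc|].
      by move=> w _; rewrite lee_fin fock_weight_ge0.
    have := le_trans H1 H2; rewrite -(fineK Xfin) -EFinM !lee_fin /B /=.
    have -> : (2^-1 ^+ 2 : R) = 4^-1 by lra.
    lra.
rewrite integral_cst//; have HD := area_disc_le 0 (ltW e0).
apply: (@le_trans _ _ ((B * fine X)%:E * (4 * e ^+ 2)%:E)%E).
  by apply: lee_wpmul2l; [rewrite lee_fin mulr_ge0 ?(ltW B0) ?fine_ge0|exact: HD].
rewrite -[in leRHS](fineK Xfin) -!EFinM lee_fin.
rewrite [leLHS](_ : _ = (4 * e ^+ 2 * B) * fine X); last by ring.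
by rewrite ler_wpM2r ?fine_ge0.
Qed.

Lemma fock_weight_off_disc (f : R[i] -> R[i]) (p s e : R) (z : R[i]) :
  0 <= s -> 0 < e -> ~ disc 0 e z ->
  fock_weight f p z <= e^-1 `^ s * (fock_weight f p z * normc z `^ s).
Proof.
move=> s0 e0; rewrite /disc /= subr0 => /negP; rewrite -leNgt => ez.
rewrite mulrCA -[leLHS]mulr1 ler_wpM2l ?fock_weight_ge0//.
rewrite -powRM ?invr_ge0 ?normc_ge0 ?(ltW e0)//.
have {1}<- : 1 `^ s = 1 :> R by rewrite powR1.
apply: ge0_ler_powR; rewrite ?nnegrE ?ler01//.
  by rewrite mulr_ge0 ?invr_ge0 ?normc_ge0 ?(ltW e0).
by rewrite mulrC ler_pdivlMr// mul1r.
Qed.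

(** Let Z and X be the integrals of the weight over the discs of radii e and 1, and
Y the right-hand integral. Then X <= Z + K Y since |z| >= e off the small disc,
and Z <= X / 2, so Z <= K Y. Subtracting Z is allowed because Z is finite. *)
Lemma fock_weight_absorb (p s : R) : 0 < p -> 0 <= s ->
  exists2 e : R, 0 < e <= 2^-1 & forall f : R[i] -> R[i], entire f ->
  (\int[@area R]_(w in disc 0%R e) (fock_weight f p w)%:E <=
   (e^-1 `^ s)%:E * \int[@area R]_z (fock_weight f p z * normc z `^ s)%:E)%E.
Proof.
move=> p0 s0; have [e /andP[e0 e2] He] := fock_weight_small_disc p0.
exists e; first by rewrite e0.
move=> f ef; have {He} := He f ef.
set Z := integral _ (disc _ e) _; set X := integral _ (disc _ 1) _.
set Y := integral _ setT _.
have mphis : measurable_fun setT (fun z => (fock_weight f p z * normc z `^ s)%:E).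
  apply/measurable_EFinP; apply: measurable_funM; first exact: measurable_fock_weight.
  exact: (measurableT_comp (measurable_powR s) measurable_normc).
have phis0 z : (0 <= (fock_weight f p z * normc z `^ s)%:E)%E.
  by rewrite lee_fin mulr_ge0 ?powR_ge0.
have mphiD D' : measurable_fun D' (EFin \o fock_weight f p).
  by apply/measurable_EFinP; apply: measurable_funTS; exact: measurable_fock_weight.
have mD := measurable_disc 0 e; have mD1 := measurable_disc 0 1.
have Xfin : X \is a fin_num by exact: fock_weight_disc_fin_num.
have Zfin : Z \is a fin_num by exact: fock_weight_disc_fin_num (ltW e0).
have Y0 : (0 <= Y)%E by apply: integral_ge0 => z _; exact: phis0.
have K0 : 0 < e^-1 `^ s by rewrite powR_gt0// invr_gt0.
have DD1 : disc 0 e `<=` disc 0 1 by move=> z; rewrite /disc /=; lra.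
have XZ : (X <= Z + (e^-1 `^ s)%:E * Y)%E.
  rewrite /X -(setDUK DD1) ge0_integral_setU//=; last 3 first.
  - exact: measurableD.
  - by move=> z _; rewrite lee_fin fock_weight_ge0.
  - by apply/disj_setPS => z [Dz []].
  rewrite leeD2l//.
  apply: (@le_trans _ _ (\int[@area R]_(z in disc 0%R 1 `\` disc 0%R e)
      ((e^-1 `^ s)%:E * (fock_weight f p z * normc z `^ s)%:E))%E).
    apply: ge0_le_integral => //.
    - exact: measurableD.
    - by move=> z _; rewrite lee_fin fock_weight_ge0.
    - by apply: measurable_funeM; exact: measurable_funTS.
    - by move=> z [_ Dz]; rewrite -EFinM lee_fin fock_weight_off_disc.
  rewrite ge0_integralZl_EFin ?(ltW K0)//; last 2 first.
  - exact: measurableD.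
  - exact: measurable_funTS.
  rewrite lee_wpmul2l ?lee_fin ?(ltW K0)//.
  by apply: ge0_subset_integral => //; exact: measurableD.
have [Yoo|Yoo] := eqVneq Y +oo%E.
  by rewrite Yoo mulry gtr0_sg// mul1e leey.
have Yfin : Y \is a fin_num by rewrite ge0_fin_numE// lt_neqAle Yoo leey.
move: XZ; rewrite -(fineK Xfin) -(fineK Yfin) -(fineK Zfin) -!EFinM -EFinD !lee_fin.
by lra.
Qed.

Lemma fock_weight_growth_le (p s : R) : 0 < p -> 0 <= s -> exists2 C : R, 0 < C &
  forall f : R[i] -> R[i], entire f ->
  (\int[@area R]_z (fock_weight f p z * (1 + normc z) `^ s)%:E <=
   C%:E * \int[@area R]_z (fock_weight f p z * normc z `^ s)%:E)%E.
Proof.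
move=> p0 s0; have [e /andP[e0 e2] He] := fock_weight_absorb p0 s0.
exists (2 `^ s * e^-1 `^ s + (1 + e^-1) `^ s).
  by rewrite addr_gt0// ?mulr_gt0// powR_gt0// ?addr_gt0// invr_gt0.
move=> f ef; have {He} := He f ef; pose phi := fock_weight f p.
set Z := integral _ (disc _ e) _; set Y := integral _ setT _ => ZY.
have phi0 z : 0 <= phi z by exact: fock_weight_ge0.
have mphi : measurable_fun setT phi by exact: measurable_fock_weight.
have mps : measurable_fun setT (fun z : R[i] => normc z `^ s).
  exact: (measurableT_comp (measurable_powR s) measurable_normc).
have mps1 : measurable_fun setT (fun z : R[i] => (1 + normc z) `^ s).
  apply: (measurableT_comp (measurable_powR s)); apply: measurable_funD => //.
  exact: measurable_normc.
have mphis : measurable_fun setT (fun z => (phi z * normc z `^ s)%:E).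
  by apply/measurable_EFinP; exact: measurable_funM.
have mD := measurable_disc 0 e.
have split_le z : phi z * (1 + normc z) `^ s <=
    2 `^ s * (\1_(disc 0 e) z * phi z) + (1 + e^-1) `^ s * (phi z * normc z `^ s).
  have [Dz|nDz] := pselect (disc 0 e z).
    rewrite indicE mem_set// mul1r; apply: ler_wpDr.
      by rewrite !mulr_ge0 ?powR_ge0.
    rewrite mulrC ler_wpM2r//.
    apply: ge0_ler_powR; rewrite ?nnegrE ?addr_ge0 ?normc_ge0//.
    by move: Dz; rewrite /disc /= subr0; lra.
  rewrite indicE memNset// mul0r mulr0 add0r mulrCA ler_wpM2l//.
  rewrite -powRM ?normc_ge0 ?addr_ge0 ?invr_ge0 ?(ltW e0)//.
  apply: ge0_ler_powR; rewrite ?nnegrE ?addr_ge0 ?mulr_ge0 ?addr_ge0;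
    rewrite ?invr_ge0 ?normc_ge0 ?(ltW e0)//.
  rewrite mulrDl mul1r addrC lerD2l mulrC ler_pdivlMr// mul1r.
  by move: nDz; rewrite /disc /= subr0 => /negP; rewrite -leNgt.
have mDphi : measurable_fun setT (fun z => (\1_(disc 0 e) z * phi z)%:E).
  by apply/measurable_EFinP; apply: measurable_funM => //; exact: measurable_indic.
apply: (@le_trans _ _ (\int[@area R]_z ((2 `^ s)%:E * (\1_(disc 0%R e) z * phi z)%:E +
    ((1 + e^-1) `^ s)%:E * (phi z * normc z `^ s)%:E))%E).
  apply: ge0_le_integral => //.
  - by move=> z _; rewrite lee_fin mulr_ge0 ?powR_ge0.
  - by apply/measurable_EFinP; exact: measurable_funM.
  - by apply: emeasurable_funD; exact: measurable_funeM.
  - by move=> z _; rewrite -!EFinM -EFinD lee_fin.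
rewrite ge0_integralD//; last 4 first.
- by move=> z _; rewrite -EFinM lee_fin !mulr_ge0 ?powR_ge0 ?indicE.
- exact: measurable_funeM.
- by move=> z _; rewrite -EFinM lee_fin !mulr_ge0 ?powR_ge0.
- exact: measurable_funeM.
rewrite !ge0_integralZl_EFin ?powR_ge0//; last 2 first.
- by move=> z _; rewrite lee_fin !mulr_ge0 ?powR_ge0.
- by move=> z _; rewrite lee_fin !mulr_ge0 ?indicE.
rewrite -(integral_indic_mul (@area R)) -/Z -/Y.
have Y0 : (0 <= Y)%E.
  by apply: integral_ge0 => z _; rewrite lee_fin mulr_ge0 ?powR_ge0.
rewrite EFinD ge0_muleDl ?lee_fin ?mulr_ge0 ?powR_ge0// leeD2r// EFinM -muleA.
by rewrite lee_wpmul2l ?lee_fin ?powR_ge0.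
Qed.

(** * From the growth of the measure to the embedding *)

Lemma fock_weight_Xn_mul (f : R[i] -> R[i]) (p : R) (m : nat) (z : R[i]) :
  fock_weight (fun w => w ^+ m * f w) p z =
  fock_weight f p z * normc z `^ (m%:R * p).
Proof.
rewrite !fock_weightE normcM normcX powRM ?exprn_ge0 ?normc_ge0//.
by rewrite -powR_mulrn ?normc_ge0// -powRrM -mulrA mulrC.
Qed.

Lemma fock_sobolev_norm_powR (f : R[i] -> R[i]) (p : R) (m : nat) : 0 < p ->
  (fock_sobolev_norm p m f `^ p =
   (p / (2 * pi))%:E *
     \int[@area R]_z (fock_weight f p z * normc z `^ (m%:R * p))%:E)%E.
Proof.
move=> p0; rewrite /fock_sobolev_norm /fock_norm -poweRrM mulVf ?gt_eqF//.
rewrite poweRe1.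
  by congr (_ * _)%E; apply: eq_integral => z _; rewrite fock_weight_Xn_mul.
apply: mule_ge0; first by rewrite lee_fin divr_ge0 ?(ltW p0)// mulr_ge0 ?pi_ge0.
by apply: integral_ge0 => z _; rewrite lee_fin fock_weight_ge0.
Qed.

Lemma fock_weight_le_disc_integral (p r : R) : 0 < p -> 0 < r -> exists2 A : R, 0 < A &
  forall (f : R[i] -> R[i]) (z : R[i]), entire f ->
  ((fock_weight f p z)%:E <=
   A%:E * \int[@area R]_(w in disc z r) (fock_weight f p w)%:E)%E.
Proof.
move=> p0 r0; have [A A0 HA] := fock_weight_disc_le p0.
have r2 : 0 < r ^+ 2 by rewrite exprn_gt0.
exists (A * expR (p / 2 * r ^+ 2) / r ^+ 2).
  by rewrite divr_gt0// mulr_gt0 ?expR_gt0.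
move=> f z ef; rewrite -(@lee_pmul2l _ (r ^+ 2)%:E) ?lte_fin// -EFinM muleA -EFinM.
rewrite [(r ^+ 2 * (_ / _))](_ : _ = A * expR (p / 2 * r ^+ 2)); first exact: HA.
by rewrite mulrC divfK ?gt_eqF.
Qed.

Lemma disc_growth_carleson (p r C : R) (m : nat) (mu : {measure set R[i] -> \bar R}) :
  0 < p -> 0 < r -> 0 < C ->
  (forall z, (mu (disc z r) <= (C * (1 + normc z) `^ (m%:R * p))%:E)%E) ->
  exists2 C' : R, 0 < C' & forall f : R[i] -> R[i], entire f ->
    (\int[mu]_z (fock_weight f p z)%:E <= C'%:E * fock_sobolev_norm p m f `^ p)%E.
Proof.
move=> p0 r0 C0 Hmu.
have sf : sigma_finite setT mu.
  by apply: (sigma_finite_disc r0) => z; rewrite (le_lt_trans (Hmu z))// ltry.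
pose sfin := isSFinite.Build _ _ _ _ (sfinite_measure_sigma_finite sf).
pose sigfin := isSigmaFinite.Build _ _ _ _ sf.
pose nu := HB.pack_for (SigmaFiniteMeasure.type R[i] R) (Measure.sort mu) sfin sigfin.
have [A A0 HA] := fock_weight_le_disc_integral p0 r0.
have mp0 : 0 <= m%:R * p by rewrite mulr_ge0 ?(ltW p0).
have [B B0 HB] := fock_weight_growth_le p0 mp0.
have c0 : 0 < p / (2 * pi) by rewrite divr_gt0 ?mulr_gt0 ?pi_gt0.
exists (A * C * B / (p / (2 * pi))).
  by rewrite divr_gt0 ?(mulr_gt0 (mulr_gt0 A0 C0) B0).
move=> f ef; rewrite fock_sobolev_norm_powR// muleA -EFinM divfK ?gt_eqF//.
have phi0 z : 0 <= fock_weight f p z by exact: fock_weight_ge0.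
have mphi := measurable_fock_weight p ef.
have mavg := @measurable_disc_integral (@area R) r _ mphi phi0.
apply: (@le_trans _ _ (A%:E *
    \int[mu]_z \int[@area R]_(w in disc z r) (fock_weight f p w)%:E)%E).
  rewrite -ge0_integralZl_EFin ?(ltW A0)//; last first.
    by move=> z _; apply: integral_ge0 => w _; rewrite lee_fin.
  apply: ge0_le_integral => //.
  - by move=> z _; rewrite lee_fin.
  - exact/measurable_EFinP.
  - exact: measurable_funeM.
  - by move=> z _; exact: HA.
rewrite (@integral_disc_integral nu)// -!mulrA EFinM -muleA.
rewrite lee_wpmul2l ?lee_fin ?(ltW A0)// EFinM -muleA.
have mps1 : measurable_fun setT (fun z : R[i] => (1 + normc z) `^ (m%:R * p)).
  apply: (measurableT_comp (measurable_powR _)); apply: measurable_funD => //.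
  exact: measurable_normc.
apply: (@le_trans _ _ (C%:E * \int[@area R]_z
    (fock_weight f p z * (1 + normc z) `^ (m%:R * p))%:E)%E); last first.
  by rewrite lee_wpmul2l ?lee_fin ?(ltW C0)// HB.
rewrite -ge0_integralZl_EFin ?(ltW C0)//; last 2 first.
- by move=> z _; rewrite lee_fin mulr_ge0 ?powR_ge0.
- by apply/measurable_EFinP; exact: measurable_funM.
apply: ge0_le_integral => //.
- by move=> z _; rewrite mule_ge0 ?lee_fin.
- by apply: emeasurable_funM; [exact/measurable_EFinP|exact: (measurable_mass_disc nu)].
- by apply: measurable_funeM; apply/measurable_EFinP; exact: measurable_funM.
- move=> z _; apply: (@le_trans _ _ ((fock_weight f p z)%:E *
      (C * (1 + normc z) `^ (m%:R * p))%:E)%E).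
    by apply: lee_wpmul2l; [rewrite lee_fin|exact: Hmu].
  by rewrite -!EFinM lee_fin mulrCA.
Qed.

(** * From the embedding to the growth of the measure *)

Lemma integral_gauss1 (c : R) : 0 < c -> exists2 K : R, 0 < K & forall a : R,
  (\int[@lebesgue_measure R]_x (expR (- (c * (x - a) ^+ 2)))%:E = K%:E)%E.
Proof.
move=> c0; pose s := Num.sqrt (2 * c)^-1.
have c2 : 0 < (2 * c)^-1 by rewrite invr_gt0 mulr_gt0.
have s0 : s != 0 by rewrite gt_eqF// sqrtr_gt0.
have s2 : s ^+ 2 = (2 * c)^-1 by rewrite sqr_sqrtr// ltW.
have P0 : 0 < normal_peak s by exact: normal_peak_gt0.
exists (normal_peak s)^-1; first by rewrite invr_gt0.
move=> a; have H := integral_normal_pdf a s.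
have E x : normal_pdf a s x = normal_peak s * expR (- (c * (x - a) ^+ 2)).
  rewrite normal_pdfE// /normal_fun s2; congr (_ * expR _).
  by field; rewrite gt_eqF.
have -> : (\int[@lebesgue_measure R]_x (expR (- (c * (x - a) ^+ 2)))%:E =
    \int[@lebesgue_measure R]_x ((normal_peak s)^-1%:E * (normal_pdf a s x)%:E))%E.
  by apply: eq_integral => x _; rewrite E -EFinM mulKf ?gt_eqF.
rewrite ge0_integralZl_EFin//.
- by rewrite H mule1.
- by move=> x _; rewrite lee_fin normal_pdf_ge0.
- by apply/measurable_EFinP; exact: measurable_normal_pdf.
- by rewrite invr_ge0 ltW.
Qed.

Lemma measurable_gauss (c : R) (a : R[i]) :
  measurable_fun setT (fun z : R[i] => (expR (- (c * normc (z - a) ^+ 2)))%:E).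
Proof.
apply/measurable_EFinP; apply: (measurableT_comp (@measurable_expR R)).
apply: measurableT_comp => //; apply: measurable_funM => //.
apply: measurable_funX; apply: entire_measurable_normc.
by apply: entireD; [exact: entire_id|exact: entire_cst].
Qed.

Lemma integral_gauss_area (c : R) : 0 < c -> exists2 K : R, 0 < K & forall a : R[i],
  (\int[@area R]_z (expR (- (c * normc (z - a) ^+ 2)))%:E = K%:E)%E.
Proof.
move=> c0; have [K K0 HK] := integral_gauss1 c0.
exists (K * K); first by rewrite mulr_gt0.
move=> a.
rewrite ge0_integral_area; last 2 first.
- exact: measurable_gauss.
- by move=> z; rewrite lee_fin expR_ge0.
have mF := measurable_comp_complex_of_pair (measurable_gauss c a).
rewrite (fubini_tonelli1 _ mF); last by move=> q; rewrite lee_fin expR_ge0.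
case: a mF => a b mF.
have mg (t : R) : measurable_fun setT
    (fun y : measurableTypeR R => (expR (- (c * (y - t) ^+ 2)))%:E).
  apply/measurable_EFinP; apply: (measurableT_comp (@measurable_expR R)).
  apply: measurableT_comp => //; apply: measurable_funM => //.
  by apply: measurable_funX; exact: measurable_funB.
transitivity (\int[@lebesgue_measure R]_x
    (K%:E * (expR (- (c * (x - a) ^+ 2)))%:E))%E.
  apply: eq_integral => x _; rewrite /fubini_F -[in RHS](HK b) muleC.
  rewrite -ge0_integralZl_EFin ?expR_ge0//.
  - apply: eq_integral => y _; rewrite -EFinM -expRD; congr (expR _)%:E.
    rewrite /complex_of_pair /= -[Num.sqrt _]/(normc ((x - a) +i* (y - b))).
    by rewrite normc_sqr; ring.
rewrite ge0_integralZl_EFin ?(ltW K0)//.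
by rewrite HK.
Qed.

(** The reproducing kernel at a of the Fock space with p = 2. *)
Definition fock_kernel (a z : R[i]) : R[i] := cexp (a^*%C * z).

Lemma fock_weight_fock_kernel (a z : R[i]) (p : R) :
  fock_weight (fock_kernel a) p z =
  expR (p / 2 * normc a ^+ 2) * expR (- (p / 2 * normc (z - a) ^+ 2)).
Proof.
rewrite fock_weightE /fock_kernel normc_cexp -expRM -!expRD normc_sqrB.
by congr expR; field.
Qed.

Lemma entire_fock_kernel (a : R[i]) : entire (fock_kernel a).
Proof. by apply: (entire_comp entire_cexp); apply: entireZ; exact: entire_id. Qed.

Lemma derive1n_fock_kernel (a : R[i]) (m : nat) :
  derive1n m (fock_kernel a) = (fun z => (a^*%C) ^+ m * fock_kernel a z).
Proof.
elim: m => [|m IH]; first by apply/funext => z; rewrite derive1n0 expr0 mul1r.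
rewrite derive1nS IH; apply/funext => z; rewrite derive1E.
have [dk kE] := is_derive_cexpZ a^*%C z.
have -> : (fun w => a^*%C ^+ m * fock_kernel a w) =
    (a^*%C ^+ m) \*: (fock_kernel a) by [].
rewrite deriveZ; last exact: dk.
rewrite (_ : 'D_1 (fock_kernel a) z = a^*%C * fock_kernel a z); last exact: kE.
by rewrite -[LHS]/(_ * _) mulrA -exprSr.
Qed.

Lemma fock_sobolev_fock_kernel (a : R[i]) (p : R) (m : nat) : 0 < p ->
  fock_sobolev p m (fock_kernel a).
Proof.
move=> p0; split; first exact: entire_fock_kernel.
rewrite derive1n_fock_kernel.
have ed : entire (fun z => a^*%C ^+ m * fock_kernel a z).
  by apply: entireZ; exact: entire_fock_kernel.
split=> //; apply/integrableP; split.
  by apply/measurable_EFinP; exact: measurable_fock_weight.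
have p2 : 0 < p / 2 by rewrite divr_gt0.
have [K K0 HK] := integral_gauss_area p2.
set c := normc (a^*%C ^+ m) `^ p * expR (p / 2 * normc a ^+ 2).
have c0 : 0 <= c by rewrite mulr_ge0 ?powR_ge0 ?expR_ge0.
have wE z : fock_weight (fun w => a^*%C ^+ m * fock_kernel a w) p z =
    c * expR (- (p / 2 * normc (z - a) ^+ 2)).
  rewrite /c -[RHS]mulrA -fock_weight_fock_kernel !fock_weightE normcM powRM ?normc_ge0//.
  by rewrite mulrA.
under eq_integral do rewrite gee0_abs ?lee_fin ?fock_weight_ge0// wE EFinM.
rewrite ge0_integralZl_EFin//.
- by rewrite HK -EFinM ltry.
- exact: measurable_gauss.
Qed.

(** Use 1 + t <= exp t; the difference of the exponents is then p times the square
m^2 - m t + t^2 / 4. *)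
Lemma powR_gauss_le (p t : R) (m : nat) : 0 < p -> 0 <= t ->
  (1 + t) `^ (m%:R * p) * expR (- (p / 2 * t ^+ 2)) <=
  expR (p * m%:R ^+ 2) * expR (- (p / 4 * t ^+ 2)).
Proof.
move=> p0 t0.
apply: (@le_trans _ _ (expR (t * (m%:R * p)) * expR (- (p / 2 * t ^+ 2)))).
  rewrite ler_wpM2r ?expR_ge0// expRM; apply: ge0_ler_powR; rewrite ?nnegrE ?expR_ge0//.
  - by rewrite mulr_ge0 ?(ltW p0).
  - by rewrite addr_ge0.
  - exact: expR_ge1Dx.
rewrite -!expRD ler_expR -subr_ge0.
rewrite (_ : _ - _ = p * (t / 2 - m%:R) ^+ 2); last by field.
by rewrite mulr_ge0 ?sqr_ge0 ?ltW.
Qed.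

Lemma fock_kernel_norm_le (p : R) (m : nat) : 0 < p -> exists2 C : R, 0 < C &
  forall a : R[i],
  (fock_sobolev_norm p m (fock_kernel a) `^ p <=
   (C * expR (p / 2 * normc a ^+ 2) * (1 + normc a) `^ (m%:R * p))%:E)%E.
Proof.
move=> p0; have p4 : 0 < p / 4 by rewrite divr_gt0.
have [K K0 HK] := integral_gauss_area p4.
have c0 : 0 < p / (2 * pi) by rewrite divr_gt0 ?mulr_gt0 ?pi_gt0.
exists (p / (2 * pi) * (expR (p * m%:R ^+ 2) * K)).
  by rewrite mulr_gt0// mulr_gt0 ?expR_gt0.
move=> a; rewrite fock_sobolev_norm_powR//.
move: (p / (2 * pi)) c0 => c c0; rewrite -2!mulrA [in leRHS]EFinM.
rewrite lee_wpmul2l ?lee_fin ?(ltW c0)//.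
set e := expR (p / 2 * normc a ^+ 2); have e0 : 0 < e by exact: expR_gt0.
set A := (1 + normc a) `^ (m%:R * p); have A0 : 0 <= A by exact: powR_ge0.
set M := expR (p * m%:R ^+ 2); have M0 : 0 < M by exact: expR_gt0.
have mp0 : 0 <= m%:R * p by rewrite mulr_ge0 ?(ltW p0).
have pw z : fock_weight (fock_kernel a) p z * normc z `^ (m%:R * p) <=
    e * A * M * expR (- (p / 4 * normc (z - a) ^+ 2)).
  have zle : normc z <= (1 + normc a) * (1 + normc (z - a)).
    have := normcD (z - a) a; rewrite subrK.
    have := mulr_ge0 (normc_ge0 a) (normc_ge0 (z - a)).
    have := normc_ge0 a; have := normc_ge0 (z - a); lra.
  have Z : normc z `^ (m%:R * p) <= A * (1 + normc (z - a)) `^ (m%:R * p).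
    rewrite -powRM ?addr_ge0 ?normc_ge0//.
    apply: ge0_ler_powR; rewrite ?nnegrE ?normc_ge0//.
    by rewrite mulr_ge0 ?addr_ge0 ?normc_ge0.
  have G := powR_gauss_le m p0 (normc_ge0 (z - a)).
  rewrite fock_weight_fock_kernel -/e; move: G; rewrite -/M.
  set E2 := expR _; set E4 := expR _ => G; have E20 : 0 <= E2 by exact: expR_ge0.
  apply: (@le_trans _ _ (e * E2 * (A * (1 + normc (z - a)) `^ (m%:R * p)))).
    by rewrite ler_wpM2l// mulr_ge0// ltW.
  rewrite [leLHS](_ : _ = e * A * ((1 + normc (z - a)) `^ (m%:R * p) * E2));
    last by ring.
  by rewrite -(mulrA (e * A)) ler_wpM2l// mulr_ge0// ltW.
have mps : measurable_fun setT (fun z : R[i] => normc z `^ (m%:R * p)).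
  exact: (measurableT_comp (measurable_powR _) measurable_normc).
apply: (@le_trans _ _ (\int[@area R]_z ((e * A * M)%:E *
    (expR (- (p / 4 * normc (z - a) ^+ 2)))%:E))%E).
  apply: ge0_le_integral => //.
  - by move=> z _; rewrite lee_fin mulr_ge0 ?powR_ge0.
  - apply/measurable_EFinP; apply: measurable_funM => //.
    by apply: measurable_fock_weight; exact: entire_fock_kernel.
  - by apply: measurable_funeM; exact: measurable_gauss.
  - by move=> z _; rewrite -EFinM lee_fin.
rewrite ge0_integralZl_EFin//.
- by rewrite HK -EFinM lee_fin [leLHS](_ : _ = M * K * (e * A))//; ring.
- exact: measurable_gauss.
- by rewrite mulr_ge0 ?(ltW M0)// mulr_ge0 ?(ltW e0).
Qed.

Lemma carleson_disc_growth (p r C : R) (m : nat) (mu : {measure set R[i] -> \bar R}) :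
  0 < p -> 0 < C ->
  (forall f : R[i] -> R[i], fock_sobolev p m f ->
    (\int[mu]_z (fock_weight f p z)%:E <= C%:E * fock_sobolev_norm p m f `^ p)%E) ->
  exists2 C' : R, 0 < C' & forall z : R[i],
    (mu (disc z r) <= (C' * (1 + normc z) `^ (m%:R * p))%:E)%E.
Proof.
move=> p0 C0 H; have [K K0 HK] := fock_kernel_norm_le m p0.
set g := expR (p / 2 * r ^+ 2); have g0 : 0 < g by exact: expR_gt0.
exists (C * K * g); first by rewrite !mulr_gt0.
move=> a; set e := expR (p / 2 * normc a ^+ 2); have e0 : 0 < e by exact: expR_gt0.
have mD := measurable_disc a r.
have mw : measurable_fun setT (EFin \o fock_weight (fock_kernel a) p).
  by apply/measurable_EFinP; apply: measurable_fock_weight; exact: entire_fock_kernel.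
have L : ((e * g^-1)%:E * mu (disc a r) <=
    \int[mu]_z (fock_weight (fock_kernel a) p z)%:E)%E.
  rewrite -integral_cst//.
  apply: (@le_trans _ _
      (\int[mu]_(z in disc a r) (fock_weight (fock_kernel a) p z)%:E)%E).
    apply: ge0_le_integral => //.
    - by move=> z _; rewrite lee_fin mulr_ge0 ?invr_ge0 ?ltW.
    - exact: measurable_funTS.
    - move=> z Dz; rewrite lee_fin fock_weight_fock_kernel -/e ler_wpM2l ?(ltW e0)//.
      rewrite -expRN ler_expR lerN2 ler_wpM2l ?divr_ge0 ?(ltW p0)//.
      have zr : normc (z - a) < r by [].
      have r0 : 0 <= r by rewrite (le_trans (normc_ge0 _) (ltW zr)).
      by rewrite ler_pXn2r ?nnegrE ?normc_ge0// ltW.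
  apply: ge0_subset_integral => //.
  by move=> z _; rewrite lee_fin fock_weight_ge0.
have U : (\int[mu]_z (fock_weight (fock_kernel a) p z)%:E <=
    (C * (K * e * (1 + normc a) `^ (m%:R * p)))%:E)%E.
  apply: (le_trans (H _ (fock_sobolev_fock_kernel a m p0))).
  by rewrite EFinM lee_wpmul2l ?lee_fin ?(ltW C0).
have eg0 : 0 < e * g^-1 by rewrite mulr_gt0// invr_gt0.
rewrite -(@lee_pmul2l _ (e * g^-1)%:E) ?lte_fin//.
apply: (le_trans (le_trans L U)); rewrite -EFinM lee_fin.
rewrite [leRHS](_ : _ = C * (K * e * (1 + normc a) `^ (m%:R * p)))//.
by field; rewrite gt_eqF.
Qed.

End carleson.

Theorem theoremB (R : realType) (p : R) (m : nat) (r : R)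
  (mu : {measure set R[i] -> \bar R}) (p_gt0 : 0 < p) (m_gt0 : (0 < m)%N)
  (r_gt0 : 0 < r) :
  (exists2 C : R, 0 < C & forall f : R[i] -> R[i], fock_sobolev p m f ->
     (\int[mu]_z (fock_weight f p z)%:E
        <= C%:E * fock_sobolev_norm p m f `^ p)%E)
  <->
  (exists2 C : R, 0 < C & forall z : R[i],
     (mu (disc z r) <= (C * (1 + normc z) `^ (m%:R * p))%:E)%E).
Proof.
split=> -[C C0 H]; first exact: carleson_disc_growth C0 H.
have [C' C'0 H'] := disc_growth_carleson p_gt0 r_gt0 C0 H.
by exists C' => // f [ef _]; exact: H'.
Qed.
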